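(* The Wirtinger constants satisfy $\mathrm{Wirt}_2=2$ and $\mathrm{Wirt}_4=14$.
   Context: The comass $\|\omega\|$ of an exterior $k$-form $\omega$ on a Euclidean space is the maximal value of $\omega(v_1,\dots,v_k)$ over $k$-tuples of unit vectors. $|\cdot|$ denotes the natural Euclidean norm on exterior forms (for which the forms $dx_{i_1}\wedge\dots\wedge dx_{i_k}$, $i_1<\dots<i_k$, are orthonormal). The Wirtinger constant $\mathrm{Wirt}_n$ of $\mathbb R^{2n}$ is the maximal ratio $|\omega^2|/\|\omega\|^2$ over all nonzero $n$-forms $\omega\in\Lambda^n\mathbb R^{2n}$, where $\omega^2=\omega\wedge\omega$. Thus $\mathrm{Wirt}_2$ concerns $2$-forms on $\mathbb R^4$ and $\mathrm{Wirt}_4$ concerns $4$-forms on $\mathbb R^8$. *)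

(* Defs.v *)
From HB Require Import structures.
From mathcomp Require Import all_boot all_order all_algebra all_fingroup.
From mathcomp Require Import boolp classical_sets reals.
Set Implicit Arguments.
Unset Strict Implicit.
Unset Printing Implicit Defensive.
Import Order.TTheory GRing.Theory Num.Theory.
Local Open Scope classical_set_scope.
Local Open Scope ring_scope.

Section ExteriorForms.
Variable R : realType.
Implicit Types k n : nat.

(* A k-tuple of vectors of R^n is a matrix 'M[R]_(k, n), one vector per row. *)

(* The shape of [determinant_multilinear] and [determinant_alternate], which
   say that \det is an n-form on R^n. *)
Definition multilinear k n (w : 'M[R]_(k, n) -> R) : Prop :=
  forall (A B C : 'M[R]_(k, n)) (i0 : 'I_k) (b c : R),
    row i0 A = b *: row i0 B + c *: row i0 C ->
    row' i0 B = row' i0 A ->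
    row' i0 C = row' i0 A ->
    w A = b * w B + c * w C.

Definition alternate k n (w : 'M[R]_(k, n) -> R) : Prop :=
  forall (A : 'M[R]_(k, n)) (i1 i2 : 'I_k),
    i1 != i2 -> row i1 A = row i2 A -> w A = 0.

Definition exterior_form k n (w : 'M[R]_(k, n) -> R) : Prop :=
  multilinear w /\ alternate w.

(* The factor 1 / (k! l!) makes dx_1 /\ ... /\ dx_n equal to \det, i.e., the
   forms dx_{i_1} /\ ... /\ dx_{i_k} are the k x k minors. *)
Definition wedge k l n (w : 'M[R]_(k, n) -> R) (h : 'M[R]_(l, n) -> R)
    (A : 'M[R]_(k + l, n)) : R :=
  (k`! * l`!)%:R^-1 *
  \sum_(s : 'S_(k + l))
     (-1) ^+ s * (w (usubmx (row_perm s A)) * h (dsubmx (row_perm s A))).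

(* The norm `|u| of the library on row vectors is the sup norm. *)
Definition euclidean_norm n (u : 'rV[R]_n) : R :=
  Num.sqrt (\sum_(j < n) u 0 j ^+ 2).

Definition increasing k n (f : {ffun 'I_k -> 'I_n}) : bool :=
  [forall i : 'I_k, forall j : 'I_k, (i < j)%N ==> (f i < f j)%N].

(* The coefficient of dx_{f 0} /\ ... /\ dx_{f (k-1)} in w is
   w (e_{f 0}, ..., e_{f (k-1)}). *)
Definition form_norm k n (w : 'M[R]_(k, n) -> R) : R :=
  Num.sqrt (\sum_(f : {ffun 'I_k -> 'I_n} | increasing f)
              w (\matrix_(i < k) delta_mx 0 (f i)) ^+ 2).

(* The largest element of A; 0 if there is none. *)
Definition maxval (A : set R) : R := xget 0 (A `&` ubound A).

Lemma maxval_eq (A : set R) (m : R) : A m -> ubound A m -> maxval A = m.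
Proof.
move=> Am ubm; rewrite /maxval; case: xgetP => [x _ [Ax ubx]|/(_ m) []] //.
by apply/eqP; rewrite eq_le ubm // ubx.
Qed.

Lemma maxval_neq0 (A : set R) :
  maxval A != 0 -> A (maxval A) /\ ubound A (maxval A).
Proof. by rewrite /maxval; case: xgetP => [x -> //|_]; rewrite eqxx. Qed.

(* The maximum exists for an exterior form w as soon as 0 < n, by
   compactness. *)
Definition comass k n (w : 'M[R]_(k, n) -> R) : R :=
  maxval [set w A | A in
            [set A : 'M[R]_(k, n) | forall i, euclidean_norm (row i A) = 1]].

(* By [maxval_neq0], a nonzero value is an attained maximum. *)
Definition Wirt n : R :=
  maxval [set form_norm (wedge w w) / comass w ^+ 2 | w in
            [set w : 'M[R]_(n, 2 * n) -> R |
               exterior_form w /\ w <> (fun=> 0)]].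

End ExteriorForms.

(* Main.v *)
Require Import Defs.
From mathcomp Require Import all_boot all_order all_algebra.
From mathcomp Require Import reals.
From mathcomp Require Import all_fingroup.
From mathcomp Require Import boolp classical_sets functions.
From mathcomp Require Import topology normedtype derive.
From mathcomp Require Import ring lra zify.

(** Why the theorem holds.

    Upper bound. Let n be 2 or 4 and let w be an n-form on R^(2n). In an
    oriented orthonormal frame g the square of w is a multiple of the volume
    form with coefficient the sum, over the complementary pairs (T, T') of
    n-subsets of the frame, of 2 sgn(T, T') w(g_T) w(g_T'). The absolute value
    of this number is at most eps times the sum over only those pairs whose
    self-dual coefficient w(g_T) + eps sgn(T, T') w(g_T') is not zero, where
    eps = 1 or -1 is the sign of the square: the other pairs contribute
    nothing positive. Each pair that remains contributes at most
    2 (comass w)^2. So it is enough to find a frame in which only 1 pair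
    (n = 2) or 7 pairs (n = 4) of self-dual coefficients survive. This gives
    the constants 2 and 14.

    The frame is a maximum point. Index the basis of R^8 by F_2^3; the
    surviving sets are to be the 14 affine planes, that is, the 4-sets that
    meet each coordinate plane S_k evenly. They span a Cartan subspace of the
    symmetric pair behind the action of SO(8) on self-dual 4-forms. Let
    F(g) = sum_k 2^k u(S_k), with u the self-dual coefficients of w in the
    frame g, and let g maximise F on the compact group SO(2n)
    (special_orthogonal_max). The derivatives of F along the rotations of the
    coordinate planes (i, j) vanish (weighted_critical). If T meets some S_k
    oddly, take T with |u(T)| largest and then k largest. Up to complement, T
    is S_k with one element i exchanged for an element j. The derivative in
    the direction (i, j) is then 2^k u(T) plus terms with the weights 2^l,
    l < k, each with a coefficient no larger than |u(T)|. As
    2^0 + ... + 2^(k-1) < 2^k, u(T) = 0. This is normal_form.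

    Sums over subsets are kept as sums over all permutations s of the 2n
    indices, T being the image of the front half. The number of permutations
    that give an affine plane is found from a symmetry: s_3 has to be the
    value forced by s_0, s_1, s_2, and exactly one of s_3, ..., s_7 is this
    value (card_perm_at).

    Lower bound. For n = 2 the symplectic form has comass 1 and square 2. For
    n = 4 take the Cayley form, built from octonions as half the difference
    of <x, y (z^* t)> and <x, t (z^* y)>. Both terms are at most 1 on unit
    vectors because the octonion norm is multiplicative (omul_norm), so the
    comass is 1 (cayley_le1). Its square is evaluated by expansion over the
    basis (cayley_square). *)

Set Implicit Arguments.
Unset Strict Implicit.
Unset Printing Implicit Defensive.
Import Order.TTheory GRing.Theory Num.Theory.
Import numFieldNormedType.Exports.
Local Open Scope ring_scope.

(** * Multilinear and alternating functions of frames *)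

Section Forms.
Variable R : realType.

Definition setrow k n (p : 'I_k) (v : 'rV[R]_n) (A : 'M[R]_(k, n)) :=
  \matrix_(i, j) if i == p then v 0 j else A i j.

Definition basis_frame k n (f : 'I_k -> 'I_n) : 'M[R]_(k, n) :=
  \matrix_(i < k) delta_mx 0 (f i).

Lemma row_setrow k n p v (A : 'M[R]_(k, n)) x :
  row x (setrow p v A) = if x == p then v else row x A.
Proof. by apply/rowP=> j; rewrite !mxE; case: eqP; rewrite ?mxE. Qed.

Lemma setrow_id k n p (A : 'M[R]_(k, n)) : setrow p (row p A) A = A.
Proof. by apply/matrixP=> i j; rewrite !mxE; case: eqP => // ->. Qed.

Lemma setrowC k n p q u v (A : 'M[R]_(k, n)) : p != q ->
  setrow p u (setrow q v A) = setrow q v (setrow p u A).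
Proof.
move=> pq; apply/matrixP=> i j; rewrite !mxE.
by case: eqP => // ->; rewrite (negPf pq).
Qed.

Lemma row_row_perm k n s (A : 'M[R]_(k, n)) x :
  row x (row_perm s A) = row (s x) A.
Proof. by apply/rowP=> j; rewrite !mxE. Qed.

Lemma multilinearP k n (w : 'M[R]_(k, n) -> R) :
  multilinear w <->
  (forall A p a b u v,
     w (setrow p (a *: u + b *: v) A) =
     a * w (setrow p u A) + b * w (setrow p v A)).
Proof.
split=> [Hw A p a b u v | Hw A B C p b c rowA rowB rowC].
  apply: (Hw _ _ _ p); first by rewrite !row_setrow eqxx.
  - by apply/matrixP=> i j; rewrite !mxE /= eq_sym (negPf (neq_lift _ _)).
  - by apply/matrixP=> i j; rewrite !mxE /= eq_sym (negPf (neq_lift _ _)).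
have off D : row' p D = row' p A -> D = setrow p (row p D) A.
  move=> eqD; apply/row_matrixP=> x; rewrite row_setrow.
  have [-> // | ] := eqVneq x p.
  rewrite eq_sym => /unlift_some[y -> _].
  by apply/rowP=> j; move/matrixP/(_ y j): eqD; rewrite !mxE.
by rewrite (off _ rowB) (off _ rowC) -Hw -rowA setrow_id.
Qed.

Lemma multilinear0 k n (w : 'M[R]_(k, n) -> R) p A :
  multilinear w -> w (setrow p 0 A) = 0.
Proof.
move=> /multilinearP Hw; have := Hw A p 0 0 0 0.
by rewrite !scale0r addr0 !mul0r addr0.
Qed.

Lemma multilinear_sum k n (w : 'M[R]_(k, n) -> R) p A (I : Type) (r : seq I)
    (c : I -> R) (u : I -> 'rV_n) :
  multilinear w ->
  w (setrow p (\sum_(i <- r) c i *: u i) A) =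
  \sum_(i <- r) c i * w (setrow p (u i) A).
Proof.
move=> mw; elim: r => [|i r IHr]; first by rewrite !big_nil multilinear0.
rewrite !big_cons -[X in _ + X]scale1r.
by move/multilinearP: (mw) => ->; rewrite mul1r IHr.
Qed.

Lemma multilinear_comb k n (w h : 'M[R]_(k, n) -> R) (a b : R) :
  multilinear w -> multilinear h -> multilinear (fun A => a * w A + b * h A).
Proof.
move=> /multilinearP Hw /multilinearP Hh; apply/multilinearP=> *.
by rewrite Hw Hh !mulrDr !mulrA [a * _]mulrC [b * _]mulrC [a * _]mulrC
  [b * _]mulrC addrACA.
Qed.

(** The induction is on the number m of rows that need not be basis vectors;
    such a row is expanded in the basis. *)
Lemma multilinear_eq k n (w h : 'M[R]_(k, n) -> R) :
    multilinear w -> multilinear h ->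
    (forall f : {ffun 'I_k -> 'I_n},
       w (basis_frame f) = h (basis_frame f)) ->
  w =1 h.
Proof.
move=> mw mh eqwh A; apply/eqP; rewrite -subr_eq0; apply/eqP.
pose d B := 1 * w B + (-1) * h B.
have md : multilinear d by apply: multilinear_comb.
suff main m : forall B : 'M_(k, n),
    (forall i : 'I_k, (m <= i)%N -> exists j, row i B = delta_mx 0 j) -> d B = 0.
  by have := main k A; rewrite /d mul1r mulN1r; apply=> i; rewrite leqNgt ltn_ord.
elim: m => [|m IHm] B basisB.
  have /fin_all_exists[f Bf] i := basisB i isT.
  have -> : B = basis_frame [ffun i => f i].
    by apply/row_matrixP=> i; rewrite rowK ffunE.
  by rewrite /d eqwh mul1r mulN1r subrr.
have [ltmk | lekm] := ltnP m k; last first.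
  by apply: IHm => i /(leq_trans lekm); rewrite leqNgt ltn_ord.
pose p := Ordinal ltmk.
rewrite -(setrow_id p B) {1}[row p B]row_sum_delta multilinear_sum //.
apply: big1 => j _; rewrite IHm ?mulr0 // => i lemi.
rewrite row_setrow; case: eqP => [_ | /eqP ne_ip]; first by exists j.
by apply: basisB; rewrite ltn_neqAle lemi andbT eq_sym.
Qed.

(** Polarisation of w (u + v, u + v) = 0. *)
Lemma alternate_tperm k n (w : 'M[R]_(k, n) -> R) i j A :
  exterior_form w -> i != j -> w (row_perm (tperm i j) A) = - w A.
Proof.
move=> [/multilinearP mw aw] ne_ij.
pose G u v := w (setrow i u (setrow j v A)).
have G0 u : G u u = 0.
  by apply: (aw _ i j) => //; rewrite !row_setrow eqxx eq_sym (negPf ne_ij) eqxx.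
have GDl u v x : G (u + v) x = G u x + G v x.
  by rewrite /G -[u]scale1r -[v]scale1r mw !mul1r !scale1r.
have GDr u v x : G x (u + v) = G x u + G x v.
  rewrite /G !(setrowC x) // -[u]scale1r -[v]scale1r mw !mul1r !scale1r.
  by rewrite -!(setrowC x).
have /eqP := G0 (row i A + row j A).
rewrite GDl !GDr !G0 add0r addr0 addrC addr_eq0 => /eqP.
rewrite {2}/G setrow_id setrow_id => <-.
congr (w _); apply/row_matrixP=> x; rewrite !row_setrow.
rewrite row_row_perm permE /=.
by case: eqP => // _; case: eqP.
Qed.

(** A |-> w A and A |-> - w (A with two rows swapped) are both multilinear,
    so they can be compared on the basis alone. *)
Lemma alternate_basis k n (w : 'M[R]_(k, n) -> R) :
    multilinear w ->
    (forall (f : {ffun 'I_k -> 'I_n}) i j, i != j ->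
      w (basis_frame (f \o tperm i j)) = - w (basis_frame f)) ->
  alternate w.
Proof.
move=> mw aw A i j ne_ij eqA.
pose h B := -1 * w (row_perm (tperm i j) B) + 0 * w B.
have mh : multilinear h.
  apply: multilinear_comb => //; apply/multilinearP=> B p a b u v.
  have push x : row_perm (tperm i j) (setrow p x B) =
      setrow (tperm i j p) x (row_perm (tperm i j) B).
    apply/matrixP=> y z; rewrite !mxE.
    by rewrite -(inj_eq (@perm_inj _ (tperm i j)) y) tpermK.
  by rewrite !push; move/multilinearP: mw => ->.
have eqf (f : {ffun 'I_k -> 'I_n}) : w (basis_frame f) = h (basis_frame f).
  rewrite /h mul0r addr0 mulN1r -[LHS]opprK -(aw f i j) //.
  by congr (- w _); apply/row_matrixP=> x; rewrite row_row_perm !rowK.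
have := multilinear_eq mw mh eqf A.
have -> : h A = - w A.
  rewrite /h mul0r addr0 mulN1r; congr (- w _).
  apply/row_matrixP=> x; rewrite row_row_perm.
  by case: tpermP => // ->; rewrite ?eqA.
by move/eqP; rewrite -addr_eq0 -mulr2n mulrn_eq0 /= => /eqP.
Qed.

Lemma alternate_perm k n (w : 'M[R]_(k, n) -> R) s A :
  exterior_form w -> w (row_perm s A) = (-1) ^+ s * w A.
Proof.
move=> ew; have [ts -> dts] := prod_tpermP s.
elim: ts dts A => [|[i j] ts IHts] /=.
  by move=> _ A; rewrite big_nil odd_perm1 expr0 mul1r row_perm1.
case/andP=> ne_ij dts A; rewrite big_cons /= row_permM alternate_tperm //.
by rewrite IHts // odd_permM odd_tperm ne_ij /= signrN mulNr.
Qed.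

Lemma det_exterior n : exterior_form (determinant : 'M[R]_n -> R).
Proof.
split=> [B C D i b c rB rC rD | A i j ne_ij eqr].
  exact: determinant_multilinear rB rC rD.
apply: (determinant_alternate ne_ij) => z.
by move/rowP/(_ z): eqr; rewrite !mxE.
Qed.

(** Uniqueness of the volume form: both sides are multilinear, and on basis
    vectors both vanish unless these are a permutation of the standard frame. *)
Lemma exterior_form_det n (w : 'M[R]_n -> R) A :
  exterior_form w -> w A = \det A * w 1%:M.
Proof.
move=> ew; pose h (B : 'M[R]_n) := w 1%:M * \det B + 0 * \det B.
suff /(_ A) : w =1 h by rewrite /h mul0r addr0 mulrC.
have [mdet _] := det_exterior n.
apply: multilinear_eq (ew.1) (multilinear_comb _ _ mdet mdet) _ => f.
rewrite /h mul0r addr0.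
have [/injectiveP injf | /injectivePn[i [j ne_ij eqf]]] := boolP (injectiveb f).
  have -> : basis_frame f = row_perm (perm injf) 1%:M.
    by apply/row_matrixP=> i; rewrite rowK row_row_perm permE row1.
  by rewrite alternate_perm // row_permE mulmx1 det_perm mulrC.
have eqr : row i (basis_frame f) = row j (basis_frame f) by rewrite !rowK eqf.
rewrite (ew.2 _ _ _ ne_ij eqr) (determinant_alternate ne_ij) ?mulr0 // => z.
by move/rowP/(_ z): eqr; rewrite ![row _ _ _ _]mxE.
Qed.

End Forms.

(** * The wedge product *)

Section Wedge.
Variable R : realType.

(** If the rows i and j agree, the terms of s and s * tperm i j cancel. *)
Lemma wedge_exterior k l n (w : 'M[R]_(k, n) -> R) (h : 'M[R]_(l, n) -> R) :
  multilinear w -> multilinear h -> exterior_form (wedge w h).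
Proof.
move=> /multilinearP mw /multilinearP mh; split.
  apply/multilinearP=> A p a b u v; rewrite /wedge; move: (_^-1) => c.
  rewrite !mulr_sumr -big_split; apply: eq_bigr => s _ /=.
  have row_set (x : 'rV[R]_n) y :
      row y (row_perm s (setrow p x A)) =
      if y == (s^-1)%g p then x else row y (row_perm s A).
    by rewrite !row_row_perm row_setrow (can2_eq (permK s) (permKV s)).
  case: (split_ordP ((s^-1)%g p)) => q def_q; rewrite def_q in row_set.
  - have up x : usubmx (row_perm s (setrow p x A)) =
        setrow q x (usubmx (row_perm s A)).
      apply/row_matrixP=> y; rewrite row_setrow !row_usubmx row_set.
      by rewrite (inj_eq (@lshift_inj _ _)).
    have dn x : dsubmx (row_perm s (setrow p x A)) = dsubmx (row_perm s A).
      apply/row_matrixP=> y; rewrite !row_dsubmx row_set.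
      by rewrite eq_rlshift.
    by rewrite !up !dn mw; move: (_ ^+ _) => z; ring.
  - have up x : usubmx (row_perm s (setrow p x A)) = usubmx (row_perm s A).
      apply/row_matrixP=> y; rewrite !row_usubmx row_set.
      by rewrite eq_lrshift.
    have dn x : dsubmx (row_perm s (setrow p x A)) =
        setrow q x (dsubmx (row_perm s A)).
      apply/row_matrixP=> y; rewrite row_setrow !row_dsubmx row_set.
      by rewrite (inj_eq (@rshift_inj _ _)).
    by rewrite !up !dn mh; move: (_ ^+ _) => z; ring.
move=> A i j ne_ij eqA; rewrite /wedge; set S := (X in _ * X).
suff /eqP : S = - S.
  by rewrite -addr_eq0 -mulr2n mulrn_eq0 /= => /eqP ->; rewrite mulr0.
rewrite {1}/S (reindex_inj (mulIg (tperm i j))) -sumrN /=.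
apply: eq_bigr => s _; rewrite odd_permM odd_tperm ne_ij addbT signrN mulNr.
suff -> : row_perm (s * tperm i j) A = row_perm s A by [].
apply/row_matrixP=> x; rewrite !row_row_perm permM.
by case: tpermP => // ->; rewrite eqA.
Qed.

End Wedge.

(** * A maximum on the special orthogonal group *)

Section Maximum.
Local Open Scope classical_set_scope.
Local Open Scope ring_scope.
Variable R : realType.

Lemma multilinear_expand k n (w : 'M[R]_(k, n) -> R) A : multilinear w ->
  w A = \sum_(f : {ffun 'I_k -> 'I_n})
          w (basis_frame R f) * \prod_(i < k) A i (f i).
Proof.
move=> mw; pose h B := \sum_(f : {ffun 'I_k -> 'I_n})
  w (basis_frame R f) * \prod_(i < k) B i (f i).
apply: (multilinear_eq mw (h := h)) => [|g].
  apply/multilinearP=> B p a b u v.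
  rewrite /h !mulr_sumr -big_split; apply: eq_bigr => f _ /=.
  have split_prod x : \prod_(i < k) setrow p x B i (f i) =
      x 0 (f p) * \prod_(i < k | i != p) B i (f i).
    rewrite (bigD1 p) //= !mxE eqxx; congr (_ * _).
    by apply: eq_bigr => i ne_ip; rewrite !mxE (negPf ne_ip).
  by rewrite !split_prod !mxE; ring.
rewrite /h (bigD1 g) //= big1 ?mulr1 => [|i _]; last first.
  by rewrite !mxE !eqxx.
rewrite big1 ?addr0 // => f ne_fg.
have [i ne_i] : exists i, f i != g i.
  by apply/existsP; apply: contraNT ne_fg; rewrite negb_exists => /forallP eqfg;
     apply/eqP/ffunP=> i; apply/eqP; have := eqfg i; rewrite negbK.
by rewrite (bigD1 i) //= !mxE eqxx (negPf ne_i) mul0r mulr0.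
Qed.

Definition special_orthogonal n (g : 'M[R]_n) : Prop :=
  g *m g^T = 1%:M /\ \det g = 1.

(** Matrices are flattened because the compactness of boxes is a statement
    about row vectors. *)
Definition mx_continuous m n (F : 'M[R]_(m, n) -> R) : Prop :=
  continuous (fun v : 'rV[R]_(m * n) => F (vec_mx v)).

Lemma mx_continuous_entry m n i j :
  mx_continuous (fun g : 'M[R]_(m, n) => g i j).
Proof.
rewrite /mx_continuous (_ : (fun _ => _) =
  (fun v : 'rV[R]_(m * n) => v 0 (mxvec_index i j))).
  exact: coord_continuous.
by apply/funext=> v; rewrite mxE.
Qed.

Lemma mx_continuousD m n (F G : 'M[R]_(m, n) -> R) :
  mx_continuous F -> mx_continuous G -> mx_continuous (fun g => F g + G g).
Proof. by move=> cF cG v; apply: continuousD; [exact: cF | exact: cG]. Qed.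

Lemma mx_continuousM m n (F G : 'M[R]_(m, n) -> R) :
  mx_continuous F -> mx_continuous G -> mx_continuous (fun g => F g * G g).
Proof. by move=> cF cG v; apply: continuousM; [exact: cF | exact: cG]. Qed.

Lemma mx_continuousZ m n c (F : 'M[R]_(m, n) -> R) :
  mx_continuous F -> mx_continuous (fun g => c * F g).
Proof. by move=> cF; apply: mx_continuousM => // v; apply: cst_continuous. Qed.

Lemma mx_continuous_sum m n (I : Type) (r : seq I)
    (F : I -> 'M[R]_(m, n) -> R) :
  (forall i, mx_continuous (F i)) ->
  mx_continuous (fun g => \sum_(i <- r) F i g).
Proof.
move=> cF; apply: continuous_big => [|i _]; first exact: add_continuous.
exact: cF.
Qed.

Lemma mx_continuous_form k m n (w : 'M[R]_(k, n) -> R) (e : 'I_k -> 'I_m) :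
  multilinear w -> mx_continuous (fun g : 'M[R]_(m, n) => w (rowsub e g)).
Proof.
move=> mw; rewrite (_ : (fun _ => _) = fun g : 'M[R]_(m, n) =>
    \sum_(f : {ffun 'I_k -> 'I_n})
      w (basis_frame R f) * \prod_(i < k) g (e i) (f i)); last first.
  apply/funext=> g; rewrite (multilinear_expand _ mw).
  by apply: eq_bigr => f _; under eq_bigr do rewrite mxE.
apply: mx_continuous_sum => f; apply: mx_continuousZ.
apply: continuous_big => [|i _]; first exact: mul_continuous.
exact: mx_continuous_entry.
Qed.

Lemma orthogonal_entry n (g : 'M[R]_n) i j :
  g *m g^T = 1%:M -> `|g i j| <= 1.
Proof.
move/matrixP/(_ i i); rewrite !mxE eqxx (bigD1 j) //= mxE -expr2 => sum1.
rewrite -(@expr_le1 _ 2) // real_normK ?num_real // -[leRHS]sum1 lerDl.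
by apply: sumr_ge0 => k _; rewrite mxE -expr2 sqr_ge0.
Qed.

Lemma special_orthogonal_max n (F : 'M[R]_n -> R) :
  mx_continuous F ->
  exists2 g, special_orthogonal g &
    forall h, special_orthogonal h -> F h <= F g.
Proof.
move=> cF; pose SO := [set v : 'rV[R]_(n * n) | special_orthogonal (vec_mx v)].
have SO1 : SO !=set0.
  by exists (mxvec 1%:M); split; rewrite mxvecK ?trmx1 ?mulmx1 ?det1.
have compactSO : compact SO.
  apply: (@subclosed_compact _ _
    [set v : 'rV[R]_(n * n) | forall i, v 0 i \in `[-1, 1]]).
  - have -> : SO = \bigcap_(ij in [set: 'I_n * 'I_n])
          ((fun v : 'rV[R]_(n * n) => (vec_mx v *m (vec_mx v)^T) ij.1 ij.2) @^-1`
             [set x | x = (1%:M : 'M[R]_n) ij.1 ij.2]) `&`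
        ((fun v : 'rV[R]_(n * n) => \det (vec_mx v)) @^-1` [set x | x = 1]).
      apply/seteqP; split=> [v [gg detg]|v [gg detg]].
        by split=> // ij _ /=; rewrite gg.
      by split=> //; apply/matrixP=> i j; exact: (gg (i, j)).
    apply: closedI.
      apply: closed_bigI => -[i j] _; apply: preimage_closed; last first.
        exact: closed_eq.
      move=> v _; apply: (_ : mx_continuous
        (fun g : 'M[R]_n => (g *m g^T) i j)).
      rewrite (_ : (fun _ => _) = fun g : 'M[R]_n => \sum_k g i k * g j k).
        apply: mx_continuous_sum => k.
        by apply: mx_continuousM; exact: mx_continuous_entry.
      by apply/funext=> g; rewrite mxE; under eq_bigr do rewrite mxE.
    apply: preimage_closed; last exact: closed_eq.
    move=> v _; apply: (_ : mx_continuous (fun g : 'M[R]_n => \det g)).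
    apply: mx_continuous_sum => s; apply: mx_continuousZ.
    apply: continuous_big => [|i _]; first exact: mul_continuous.
    exact: mx_continuous_entry.
  - apply: (@rV_compact R _ (fun=> `[(-1), 1]%classic)) => _.
    exact: segment_compact.
  - move=> v [gg _] ij; case/mxvec_indexP: ij => i j.
    have := orthogonal_entry i j gg.
    by rewrite mxE in_itv /= -ler_norml.
have [v SOv maxv] := compact_EVT_max SO1 compactSO (continuous_subspaceT cF).
exists (vec_mx v) => [|h SOh]; first by rewrite inE in SOv.
by rewrite -[h]mxvecK; apply: maxv; rewrite inE /SO /= mxvecK.
Qed.

End Maximum.

(** * Rotations in coordinate planes *)

Section Rotation.
Variable R : realType.

Definition rotate m n (i j : 'I_m) (a b : R) (g : 'M[R]_(m, n)) :=
  setrow i (a *: row i g + b *: row j g)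
    (setrow j (- b *: row i g + a *: row j g) g).

Lemma rotateC m n (i j : 'I_m) a b (g : 'M[R]_(m, n)) : i != j ->
  rotate i j a b g = rotate j i a (- b) g.
Proof.
move=> ne_ij; rewrite /rotate setrowC // opprK.
by rewrite (addrC (a *: row j g)) (addrC (b *: row j g)).
Qed.

(** The four lemmas on the values of a k-form on the frame (g_(e p))_p after a
    rotation of g depend on which of the indices i and j occur in e. *)
Lemma rotate_form_none k m n (w : 'M[R]_(k, n) -> R) (e : 'I_k -> 'I_m)
    i j a b g :
  (forall p, e p != i) -> (forall p, e p != j) ->
  w (rowsub e (rotate i j a b g)) = w (rowsub e g).
Proof.
move=> ei ej; congr (w _); apply/matrixP=> x y.
by rewrite !mxE (negPf (ei x)) (negPf (ej x)).
Qed.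

Lemma rotate_form_left k m n (w : 'M[R]_(k, n) -> R) (e : 'I_k -> 'I_m)
    i j a b g p :
  multilinear w -> injective e -> e p = i -> (forall q, e q != j) ->
  w (rowsub e (rotate i j a b g)) =
    a * w (rowsub e g) + b * w (rowsub (tperm i j \o e) g).
Proof.
move=> /multilinearP mw inje ei ej.
have -> : rowsub e (rotate i j a b g) =
    setrow p (a *: row i g + b *: row j g) (rowsub e g).
  by apply/matrixP=> x y; rewrite !mxE (negPf (ej x)) -ei (inj_eq inje).
rewrite mw; congr (_ * w _ + _ * w _).
  by rewrite -ei; apply/matrixP=> x y; rewrite !mxE; case: eqP => // ->.
apply/matrixP=> x y; rewrite !mxE /=.
have [->|ne_xp] := eqVneq x p; first by rewrite ei tpermL.
by rewrite tpermD // eq_sym // -ei (inj_eq inje).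
Qed.

Lemma rotate_form_right k m n (w : 'M[R]_(k, n) -> R) (e : 'I_k -> 'I_m)
    i j a b g p :
  multilinear w -> injective e -> e p = j -> (forall q, e q != i) ->
  w (rowsub e (rotate i j a b g)) =
    a * w (rowsub e g) - b * w (rowsub (tperm i j \o e) g).
Proof.
move=> mw inje ej ei; have ne_ij : i != j by rewrite -ej eq_sym.
by rewrite rotateC // (rotate_form_left _ _ _ mw inje ej ei) mulNr tpermC.
Qed.

Lemma rotate_form_both k m n (w : 'M[R]_(k, n) -> R) (e : 'I_k -> 'I_m)
    i j a b g p q :
  exterior_form w -> injective e -> i != j -> e p = i -> e q = j ->
  w (rowsub e (rotate i j a b g)) = (a ^+ 2 + b ^+ 2) * w (rowsub e g).
Proof.
move=> ew inje ne_ij ep eq; have [/multilinearP mw aw] := ew.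
have ne_pq : p != q by rewrite -(inj_eq inje) ep eq.
pose G u v := w (setrow p u (setrow q v (rowsub e g))).
have -> : rowsub e (rotate i j a b g) =
    setrow p (a *: row i g + b *: row j g)
      (setrow q (- b *: row i g + a *: row j g) (rowsub e g)).
  by apply/matrixP=> x y; rewrite !mxE -ep -eq !(inj_eq inje).
have Gr u v x c d : G x (c *: u + d *: v) = c * G x u + d * G x v.
  by rewrite /G !(setrowC x) // mw.
have G0 u : G u u = 0.
  by apply: (aw _ p q) => //; rewrite !row_setrow eqxx eq_sym (negPf ne_pq) eqxx.
have Gij : G (row i g) (row j g) = w (rowsub e g).
  congr (w _); apply/matrixP=> x y; rewrite !mxE.
  by case: eqP => [-> | _]; [rewrite ep | case: eqP => // ->; rewrite eq].
have Gji : G (row j g) (row i g) = - w (rowsub e g).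
  rewrite -(alternate_tperm _ ew ne_pq); congr (w _); apply/matrixP=> x y.
  rewrite !mxE; case: tpermP => [->|->|/eqP/negPf-> /eqP/negPf-> //].
    by rewrite eqxx eq.
  by rewrite eqxx eq_sym (negPf ne_pq) ep.
rewrite mw -!/(G _ _) !Gr !G0 Gij Gji; ring.
Qed.

Lemma rotate_special_orthogonal n (i j : 'I_n) a b (g : 'M[R]_n) :
  i != j -> a ^+ 2 + b ^+ 2 = 1 -> special_orthogonal g ->
  special_orthogonal (rotate i j a b g).
Proof.
move=> ne_ij ab1 [gg detg]; split; last first.
  have id_sub (A : 'M[R]_n) : rowsub id A = A.
    by apply/matrixP=> x y; rewrite mxE.
  rewrite -[rotate _ _ _ _ _]id_sub.
  rewrite (rotate_form_both a b g (det_exterior R n) (@inj_id _) ne_ij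
    erefl erefl).
  by rewrite id_sub detg ab1 mulr1.
pose dot (u v : 'rV[R]_n) := (u *m v^T) 0 0.
have dotE (A : 'M[R]_n) x y : (A *m A^T) x y = dot (row x A) (row y A).
  by rewrite /dot !mxE; apply: eq_bigr => k _; rewrite !mxE.
have dotDl u v x c d : dot (c *: u + d *: v) x = c * dot u x + d * dot v x.
  by rewrite /dot mulmxDl -!scalemxAl !mxE.
have dotDr u v x c d : dot x (c *: u + d *: v) = c * dot x u + d * dot x v.
  by rewrite /dot linearD /= !linearZ /= mulmxDr -!scalemxAr !mxE.
have dotg x y : dot (row x g) (row y g) = (x == y)%:R.
  by rewrite -dotE gg mxE.
apply/matrixP=> x y; rewrite dotE !row_setrow [RHS]mxE.
have ne_ji : (j == i) = false by rewrite eq_sym (negPf ne_ij).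
have [eqx|ne_xi] := eqVneq x i; last have [eqx|ne_xj] := eqVneq x j;
  (have [eqy|ne_yi] := eqVneq y i; last have [eqy|ne_yj] := eqVneq y j).
all: rewrite ?dotDl ?dotDr ?dotg ?eqx ?eqy ?eqxx ?ne_ji ?(negPf ne_ij) //.
all: try (move: ne_yi ne_yj;
  rewrite eq_sym => /negPf->; rewrite eq_sym => /negPf->).
all: try (move: ne_xi ne_xj => /negPf-> /negPf->).
all: rewrite /= ?mulr1n ?mulr0n; try ring.
all: by rewrite -[RHS]ab1; ring.
Qed.

(** Fermat's rule on the circle: C is the derivative at (a, b) = (1, 0). The
    circle is parametrised by ((1 - t^2) / (1 + t^2), 2 t / (1 + t^2)), which
    keeps the argument algebraic. *)
Lemma circle_critical (B C : R) :
  (forall a b, a ^+ 2 + b ^+ 2 = 1 -> (a - 1) * B + b * C <= 0) -> C = 0.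
Proof.
move=> leBC.
have main t : t * C <= t ^+ 2 * B.
  have gt0 : 0 < 1 + t ^+ 2 by rewrite ltr_wpDr ?sqr_ge0.
  have nz : 1 + t ^+ 2 != 0 by rewrite gt_eqF.
  have := leBC ((1 - t ^+ 2) / (1 + t ^+ 2)) (2 * t / (1 + t ^+ 2)).
  have -> : ((1 - t ^+ 2) / (1 + t ^+ 2)) ^+ 2 +
      (2 * t / (1 + t ^+ 2)) ^+ 2 = 1.
    by field.
  have -> : ((1 - t ^+ 2) / (1 + t ^+ 2) - 1) * B + 2 * t / (1 + t ^+ 2) * C =
    (t * C - t ^+ 2 * B) * (2 / (1 + t ^+ 2)) by field.
  by move=> /(_ erefl); rewrite pmulr_lle0 ?divr_gt0 // subr_le0.
(* A small t of the sign of C makes the linear term win. *)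
have D0 : 0 < `|B| + 1 by rewrite ltr_wpDl.
have := main (C / (`|B| + 1)).
have -> : C / (`|B| + 1) * C = C ^+ 2 * (`|B| + 1) / (`|B| + 1) ^+ 2.
  by field; rewrite gt_eqF.
have -> : (C / (`|B| + 1)) ^+ 2 * B = C ^+ 2 * B / (`|B| + 1) ^+ 2.
  by field; rewrite gt_eqF.
rewrite ler_pM2r ?invr_gt0 ?exprn_gt0 // => le1.
have : C ^+ 2 * B <= C ^+ 2 * `|B| by rewrite ler_wpM2l ?sqr_ge0 ?ler_norm.
move=> le2; apply/eqP; rewrite -sqrf_eq0 eq_le sqr_ge0 andbT.
by move: le1 le2; rewrite mulrDr mulr1; lra.
Qed.

End Rotation.

(** * Self-dual coefficients *)

Section SelfDualPart.
Variables (R : realType) (n : nat).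
Implicit Types (w : 'M[R]_(n, n + n) -> R) (g : 'M[R]_(n + n)).
Implicit Types (s t : 'S_(n + n)) (x y i j : 'I_(n + n)) (eps : R).

Definition in_front s x : bool := ((s^-1)%g x < n)%N.

Lemma in_frontP s x :
  reflect (exists p, s (lshift n p) = x) (in_front s x).
Proof.
apply: (iffP idP) => [lt_n | [p <-]]; last by rewrite /in_front permK /= ltn_ord.
exists (Ordinal lt_n); rewrite -[RHS](permKV s); congr (s _).
exact: val_inj.
Qed.

Lemma in_backP s x :
  reflect (exists p, s (rshift n p) = x) (~~ in_front s x).
Proof.
rewrite /in_front; case: (split_ordP ((s^-1)%g x)) => p def_p /=.
  constructor=> -[q] /(canRL (permK s))/esym/eqP.
  by rewrite def_p eq_lrshift.
constructor; exists p.
by rewrite -def_p permKV.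
Qed.

Definition coef w g s : R := w (rowsub (s \o lshift n) g).
Definition cocoef w g s : R := w (rowsub (s \o @rshift n n) g).

(** Twice the coefficient, in the frame g, of the self-dual (eps = 1) or
    anti-self-dual (eps = -1) part of w on the vectors s_0, ..., s_(n-1). *)
Definition dual_coef w eps g s : R :=
  coef w g s + eps * (-1) ^+ s * cocoef w g s.

Lemma dual_coef_tperm w eps g s x y :
  exterior_form w -> (x < n)%N = (y < n)%N -> x != y ->
  `|dual_coef w eps g (tperm x y * s)| = `|dual_coef w eps g s|.
Proof.
move=> ew; rewrite /dual_coef odd_permM odd_tperm /coef /cocoef.
have reidx (e : 'I_n -> 'I_(n + n)) (t : 'S_n) :
    w (rowsub (e \o t) g) = w (row_perm t (rowsub e g)).
  by congr w; apply/matrixP=> p q; rewrite !mxE.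
case: (split_ordP x) => p ->; case: (split_ordP y) => q -> lt_n ne_xy.
- rewrite ne_xy signrN mulrN mulNr.
  have -> : rowsub ((tperm (lshift n p) (lshift n q) * s)%g \o lshift n) g =
      rowsub ((s \o lshift n) \o tperm p q) g.
    apply/matrixP=> a b; rewrite !mxE /= permM.
    by rewrite -(inj_tperm _ _ _ (@lshift_inj n n)).
  have -> : rowsub ((tperm (lshift n p) (lshift n q) * s)%g \o @rshift n n) g =
      rowsub (s \o @rshift n n) g.
    by apply/matrixP=> a b; rewrite !mxE /= permM tpermD // eq_lrshift.
  rewrite reidx alternate_tperm //.
  by rewrite -opprD normrN.
- by [].
- by [].
- rewrite ne_xy signrN mulrN mulNr.
  have -> : rowsub ((tperm (rshift n p) (rshift n q) * s)%g \o @rshift n n) g =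
      rowsub ((s \o @rshift n n) \o tperm p q) g.
    apply/matrixP=> a b; rewrite !mxE /= permM.
    by rewrite -(inj_tperm _ _ _ (@rshift_inj n n)).
  have -> : rowsub ((tperm (rshift n p) (rshift n q) * s)%g \o lshift n) g =
      rowsub (s \o lshift n) g.
    by apply/matrixP=> a b; rewrite !mxE /= permM tpermD // eq_rlshift.
  rewrite reidx alternate_tperm //; last by rewrite -(inj_eq (@rshift_inj n n)).
  by rewrite mulrN opprK.
Qed.

(** Up to sign a self-dual coefficient depends only on the set of its
    indices. Two permutations with the same front half (here Q) differ by
    transpositions inside the halves, each of which makes them agree at one
    more place. *)
Lemma same_front w eps g s t (Q : pred 'I_(n + n)) :
  exterior_form w ->
  (forall x, Q (s x) = (x < n)%N) -> (forall x, Q (t x) = (x < n)%N) ->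
  `|dual_coef w eps g s| = `|dual_coef w eps g t|.
Proof.
move=> ew Qs Qt; have [m] := ubnP #|[set x | s x != t x]|.
elim: m => // m IHm in s Qs *; rewrite ltnS => le_m.
have [/eqP-> // | ne_st] := boolP (s == t).
have [x ne_x] : exists x, s x != t x.
  apply/existsP; apply: contraNT ne_st; rewrite negb_exists => /forallP eqst.
  by apply/eqP/permP=> x; apply/eqP; have := eqst x; rewrite negbK.
pose y := (s^-1)%g (t x).
have sy : s y = t x by rewrite /y permKV.
have ne_xy : x != y by apply: contraNneq ne_x => eqxy; rewrite -sy -eqxy.
have eq_xy : (x < n)%N = (y < n)%N by rewrite -(Qs y) sy Qt.
rewrite -(dual_coef_tperm eps g s ew eq_xy ne_xy); apply: IHm => [z|].
  by rewrite permM Qs; case: tpermP => // ->.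
apply: leq_trans le_m; apply: proper_card; apply/properP; split.
  apply/fintype.subsetP=> z; rewrite !inE permM; case: tpermP => [->|-> _|//].
    by rewrite sy eqxx.
  by rewrite sy (inj_eq perm_inj).
by exists x; rewrite !inE // permM tpermL sy eqxx.
Qed.

(** This is where self-duality enters: the coefficients of complementary index
    sets agree up to sign. *)
Lemma dual_coef_swap_halves w eps g s (t : 'S_(n + n)) :
  (forall p, t (lshift n p) = rshift n p) ->
  (forall p, t (rshift n p) = lshift n p) ->
  ~~ odd_perm t -> `|eps| = 1 ->
  `|dual_coef w eps g (t * s)| = `|dual_coef w eps g s|.
Proof.
move=> tl tr /negPf t_even eps1; rewrite /dual_coef odd_permM t_even /=.
have -> : coef w g (t * s) = cocoef w g s.
  by congr w; apply/matrixP=> a b; rewrite !mxE /= permM tl.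
have -> : cocoef w g (t * s) = coef w g s.
  by congr w; apply/matrixP=> a b; rewrite !mxE /= permM tr.
have sq1 : (eps * (-1) ^+ s) ^+ 2 = 1.
  by rewrite exprMn sqrr_sign mulr1 -[RHS](expr1n _ 2) -eps1 -normrX
    ger0_norm // sqr_ge0.
have norm1 : `|eps * (-1) ^+ s| = 1 by rewrite normrM normr_sign eps1 mulr1.
move: (eps * _) sq1 norm1 => z z2 z1.
rewrite -[RHS]mul1r -z1 -normrM mulrDr mulrA -expr2 z2 mul1r addrC //.
Qed.

(** The sign with which the infinitesimal rotation of the plane (i, j) sends
    the index set of s to that of s * tperm i j; it is 0 when i and j lie in
    the same half. *)
Definition split_sign s i j : R := (in_front s i)%:R - (in_front s j)%:R.

(** Self-dual coefficients rotate among themselves: the sign of the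
    permutation s * tperm i j makes up for the opposite sign with which the
    coefficient of the complementary set rotates. *)
Lemma dual_coef_rotate w eps g s i j a b :
  exterior_form w -> i != j -> a ^+ 2 + b ^+ 2 = 1 ->
  dual_coef w eps (rotate i j a b g) s =
    dual_coef w eps g s
    + (a - 1) * (split_sign s i j ^+ 2 * dual_coef w eps g s)
    + b * (split_sign s i j * dual_coef w eps g (s * tperm i j)).
Proof.
move=> ew ne_ij ab1; have [mw _] := ew.
rewrite /dual_coef /coef /cocoef odd_permM odd_tperm ne_ij addbT signrN.
have reidx (e : 'I_n -> 'I_(n + n)) :
    rowsub ((s * tperm i j)%g \o e) g = rowsub (tperm i j \o (s \o e)) g.
  by apply/matrixP=> p q; rewrite !mxE /= permM.
have injl : injective (s \o lshift n).
  exact: inj_comp perm_inj (@lshift_inj n n).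
have injr : injective (s \o @rshift n n).
  exact: inj_comp perm_inj (@rshift_inj n n).
have front_l x p : ~~ in_front s x -> (s \o lshift n) p != x.
  by apply: contraNneq => /= <-; apply/in_frontP; exists p.
have front_r x p : in_front s x -> (s \o @rshift n n) p != x.
  by move=> sx; apply: contraTneq sx => /= <-; apply/in_backP; exists p.
rewrite !reidx /split_sign.
have [ij_i | ij_i] := boolP (in_front s i);
  have [ij_j | ij_j] := boolP (in_front s j); rewrite ?mulr0n ?mulr1n.
- have /in_frontP[p ep] := ij_i; have /in_frontP[q eq] := ij_j.
  rewrite (rotate_form_both _ _ _ ew injl ne_ij ep eq) ab1.
  rewrite (rotate_form_none w a b g (fun p => front_r i p ij_i)
    (fun p => front_r j p ij_j)).
  by move: (_ ^+ s) => z; ring.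
- have /in_frontP[p ep] := ij_i; have /in_backP[q eq] := ij_j.
  rewrite (rotate_form_left a b g mw injl ep (fun p => front_l j p ij_j)).
  rewrite (rotate_form_right a b g mw injr eq (fun p => front_r i p ij_i)).
  by move: (_ ^+ s) => z; ring.
- have /in_backP[p ep] := ij_i; have /in_frontP[q eq] := ij_j.
  rewrite (rotate_form_right a b g mw injl eq (fun p => front_l i p ij_i)).
  rewrite (rotate_form_left a b g mw injr ep (fun p => front_r j p ij_j)).
  by move: (_ ^+ s) => z; ring.
- have /in_backP[p ep] := ij_i; have /in_backP[q eq] := ij_j.
  rewrite (rotate_form_both _ _ _ ew injr ne_ij ep eq) ab1.
  rewrite (rotate_form_none w a b g (fun p => front_l i p ij_i)
    (fun p => front_l j p ij_j)).
  by move: (_ ^+ s) => z; ring.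
Qed.

End SelfDualPart.

(** * The normal form *)

Section NormalForm.
Variables (n K : nat).
Implicit Types (s : 'S_(n + n)) (x i j : 'I_(n + n)).
(* The sets chi k, called faces, have n elements; sel k maps the front half
   onto chi k, and any two faces meet evenly. *)
Variables (chi : 'I_K -> pred 'I_(n + n)) (sel : 'I_K -> 'S_(n + n)).

Definition miss k s : nat := (\sum_(p < n) ~~ chi k (s (lshift n p)))%N.

(** For even n, the parity of miss k s is that of the intersection of the front
    half of s with the k-th face. *)
Definition balanced s : bool := [forall k, ~~ odd (miss k s)].

Hypothesis chi_sel : forall k x, chi k (sel k x) = (x < n)%N.
Hypothesis miss_sel : forall k l, k != l -> ~~ odd (miss l (sel k)).

Lemma in_front_sel k x : in_front (sel k) x = chi k x.
Proof. by rewrite /in_front -(chi_sel k) permKV. Qed.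

Lemma miss_sel_id k : miss k (sel k) = 0%N.
Proof. by rewrite /miss big1 // => p _; rewrite chi_sel /= ltn_ord. Qed.

Lemma miss_front l s (Q : pred 'I_(n + n)) :
  (forall x, Q (s x) = (x < n)%N) -> miss l s = (\sum_(y | Q y) ~~ chi l y)%N.
Proof.
move=> Qs; rewrite (reindex_inj (@perm_inj _ s)) /= (eq_bigl _ _ Qs).
rewrite big_mkcond big_split_ord /= [X in (_ + X)%N]big1 => [|p _].
  by rewrite addn0; apply: eq_bigr => p _; rewrite ltn_ord.
by rewrite ltnNge leq_addr.
Qed.

Lemma miss_total l s :
  (miss l s + \sum_(p < n) ~~ chi l (s (rshift n p)) = n)%N.
Proof.
transitivity (\sum_(x : 'I_(n + n)) ~~ chi l (s x))%N.
  by rewrite big_split_ord.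
transitivity (\sum_(y : 'I_(n + n)) ~~ chi l y)%N.
  by rewrite [RHS](reindex_inj (@perm_inj _ s)).
rewrite (reindex_inj (@perm_inj _ (sel l))) /=.
under eq_bigr do rewrite chi_sel.
rewrite big_split_ord /= big1 => [|p _]; last by rewrite ltn_ord.
rewrite (eq_bigr (fun=> 1%N)) => [|p _]; last by rewrite ltnNge leq_addr.
by rewrite sum_nat_const card_ord muln1.
Qed.

Lemma miss_tperm l s i j : in_front s i -> ~~ in_front s j ->
  (miss l (s * tperm i j) + ~~ chi l i = miss l s + ~~ chi l j)%N.
Proof.
move=> /in_frontP[p sp] sj; rewrite /miss (bigD1 p) //= [in RHS](bigD1 p) //=.
rewrite permM sp tpermL; set a := (\sum_(_ < n | _) _)%N.
suff -> : a = (\sum_(q < n | q != p) ~~ chi l (s (lshift n q)))%N.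
  by rewrite addnC addnA [RHS]addnAC.
apply: eq_bigr => q ne_qp; rewrite permM tpermD //.
  by rewrite -sp (inj_eq perm_inj) eq_sym (inj_eq (@lshift_inj n n)).
by apply: contraNneq sj => ->; apply/in_frontP; exists q.
Qed.

Variables (R : realType) (w : 'M[R]_(n, n + n) -> R) (eps : R).
Hypothesis ew : exterior_form w.
Hypothesis eps1 : `|eps| = 1.

(** The critical point equations of a weighted sum of the self-dual
    coefficients of the faces. In normal_form each weight 2 ^ k outweighs the
    sum of the previous ones. *)
Lemma weighted_critical : exists2 g, special_orthogonal g &
  forall i j, i != j ->
    \sum_(k < K) 2 ^+ k * (split_sign R (sel k) i j *
                     dual_coef w eps g (sel k * tperm i j)) = 0.
Proof.
pose F g := \sum_(k < K) 2 ^+ k * dual_coef w eps g (sel k).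
have cF : mx_continuous F.
  apply: mx_continuous_sum => k; apply: mx_continuousZ; apply: mx_continuousD.
    exact: mx_continuous_form (ew.1).
  by apply: mx_continuousZ; exact: mx_continuous_form (ew.1).
have [g SOg maxg] := special_orthogonal_max cF; exists g => // i j ne_ij.
pose B := \sum_(k < K) 2 ^+ k *
  (split_sign R (sel k) i j ^+ 2 * dual_coef w eps g (sel k)).
apply: (@circle_critical _ B) => a b ab1.
rewrite -(lerD2l (F g)) addr0.
apply: le_trans (maxg _ (rotate_special_orthogonal ne_ij ab1 SOg)).
rewrite /F /B !mulr_sumr -!big_split /= ler_sum // => k _.
rewrite dual_coef_rotate //; move: (2 ^+ k) => z; rewrite le_eqVlt.
by apply/orP; left; apply/eqP; ring.
Qed.

Hypothesis n_even : ~~ odd n.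
Hypothesis n_le4 : (n <= 4)%N.
Variable swap : 'S_(n + n).
Hypothesis swapl : forall p, swap (lshift n p) = rshift n p.
Hypothesis swapr : forall p, swap (rshift n p) = lshift n p.
Hypothesis swap_even : ~~ odd_perm swap.

Lemma miss_le l s : (miss l s <= n)%N.
Proof. by rewrite -[leqRHS](miss_total l s) leq_addr. Qed.

Lemma miss_swap l s : (miss l (swap * s) = n - miss l s)%N.
Proof.
apply/eqP; rewrite -(eqn_add2l (miss l s)) subnKC ?miss_le //.
rewrite -[X in _ == X](miss_total l s) eqn_add2l; apply/eqP.
apply: eq_bigr => p _.
by rewrite permM swapl.
Qed.

(** The front half of s is the k-th face with i exchanged for j. *)
Lemma miss1_exchange k s : miss k s = 1%N ->
  exists i j, [/\ chi k i, ~~ chi k j, in_front s j, ~~ in_front s i &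
                  forall x, chi k (tperm i j (s x)) = (x < n)%N].
Proof.
move=> miss1; have := miss_total k s; rewrite miss1 => def_n.
have /eqP/sum_nat_eq1[p [_ /eqP ep np]] := miss1.
have : (\sum_(q < n) chi k (s (rshift n q)) = 1)%N.
  have : (\sum_(q < n) (chi k (s (rshift n q)) + ~~ chi k (s (rshift n q))) = n)%N.
    rewrite (eq_bigr (fun=> 1%N)) => [|q _]; last by case: (chi _ _).
    by rewrite sum_nat_const card_ord muln1.
  by rewrite big_split /= -[in RHS]def_n => /addIn.
move=> /eqP/sum_nat_eq1[q [_ /eqP eq nq]].
exists (s (rshift n q)), (s (lshift n p)).
have chi_i : chi k (s (rshift n q)) by move: eq; case: (chi _ _).
have chi_j : ~~ chi k (s (lshift n p)) by move: ep; case: (chi _ _).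
split=> //.
- by apply/in_frontP; exists p.
- by apply/in_backP; exists q.
move=> x; case: (split_ordP x) => y -> /=.
- have [->|ne_yp] := eqVneq y p; first by rewrite tpermR.
  rewrite tpermD ?(inj_eq perm_inj) ?eq_rlshift //; last first.
    by rewrite eq_sym (inj_eq (@lshift_inj n n)).
  by have := np y ne_yp isT; case: (chi _ _).
- have [->|ne_yq] := eqVneq y q; first by rewrite tpermL (negPf chi_j).
  rewrite tpermD ?(inj_eq perm_inj) ?eq_lrshift //; last first.
    by rewrite eq_sym (inj_eq (@rshift_inj n n)).
  by have := nq y ne_yq isT; case: (chi _ _).
Qed.

Lemma sum_pow2 (k : 'I_K) :
  \sum_(l < K | (l < k)%N) 2 ^+ l = 2 ^+ k - 1 :> R.
Proof.
rewrite -(big_ord_widen K (fun l => 2 ^+ l : R)) ?(ltnW (ltn_ord k)) //.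
by rewrite [RHS]subrX1 [2 - 1](_ : _ = 1) ?mul1r //; ring.
Qed.

(** Diagonal dominance. Among the unbalanced s let |u s| be largest, and let k
    be the largest face that s meets oddly. As n <= 4, the front half of s, or
    of its complement, is the k-th face with one element i exchanged for an
    element j. In the critical equation of (i, j) the term of k is
    2 ^ k * u s up to sign (u_k); the terms l > k vanish since i and j lie on
    the same side of these faces (high); the terms l < k are bounded by
    2 ^ l * |u s|, since the sets that occur are again unbalanced (low). *)
Lemma normal_form : exists2 g, special_orthogonal g &
  forall s, ~~ balanced s -> dual_coef w eps g s = 0.
Proof.
have [g SOg crit] := weighted_critical; exists g => // s0 unbal0.
pose u := dual_coef w eps g.
have [s unbal_s max_s] :
    exists2 s, ~~ balanced s & forall t, ~~ balanced t -> `|u t| <= `|u s|.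
  have := @Order.TotalTheory.arg_maxP _ _ 'S_(n + n) s0
    (fun s => ~~ balanced s) (fun s => `|u s|) unbal0.
  by case=> s us max_s; exists s.
suff : `|u s| <= 0 by move/(le_trans (max_s _ unbal0)); rewrite normr_le0 => /eqP.
have [k0 odd_k0] : exists k, odd (miss k s).
  by move: unbal_s; rewrite negb_forall => /existsP[k]; rewrite negbK; exists k.
have [k odd_k max_k] :
    exists2 k, odd (miss k s) & forall l : 'I_K, (k < l)%N -> ~~ odd (miss l s).
  case: (@arg_maxnP _ k0 (fun k => odd (miss k s)) (fun k => k : nat) odd_k0).
  move=> k odd_k max_k; exists k => // l ltkl.
  by apply: contraL ltkl => /max_k; rewrite -leqNgt.
(* t is s, or s with its halves exchanged if the front half of s has only one
   element in common with the k-th face. *)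
have [t ut [miss_t par_t]] : exists2 t, `|u t| = `|u s| &
    miss k t = 1%N /\ forall l, odd (miss l t) = odd (miss l s).
  have [miss1 | miss1] := eqVneq (miss k s) 1%N; first by exists s.
  exists (swap * s)%g; first by apply: dual_coef_swap_halves.
  split=> [|l]; rewrite miss_swap; last first.
    by rewrite oddB ?miss_le // (negPf n_even).
  have := miss_le k s; move: (miss k s) odd_k miss1 n_le4 n_even => m.
  by clear; case: n m => [|[|[|[|[|n']]]]] [|[|[|[|[|m]]]]].
have [i [j [chi_i chi_j front_j front_i tQ]]] := miss1_exchange miss_t.
have ne_ij : i != j by apply: contraTneq chi_i => ->.
have sign_k : split_sign R (sel k) i j = 1.
  by rewrite /split_sign !in_front_sel chi_i (negPf chi_j) mulr0n subr0.
have u_k : `|u (sel k * tperm i j)%g| = `|u s|.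
  rewrite -ut; apply: (@same_front _ _ _ _ _ _ _
    (fun y => chi k (tperm i j y))) => // x.
  by rewrite permM tpermK chi_sel.
have high (l : 'I_K) : (k < l)%N -> split_sign R (sel l) i j = 0.
  move=> ltkl; rewrite /split_sign !in_front_sel.
  suff -> : chi l i = chi l j by rewrite subrr.
  have := miss_tperm l front_j front_i; rewrite tpermC.
  have -> : miss l (t * tperm i j) = miss l (sel k).
    rewrite (@miss_front _ _ (chi k)) => [|x]; last by rewrite permM.
    by rewrite -(miss_front l (chi_sel k)).
  move=> /(congr1 odd); rewrite !oddD par_t (negPf (max_k _ ltkl)).
  have ne_kl : k != l by apply: contraTneq ltkl => ->; rewrite ltnn.
  by rewrite (negPf (miss_sel ne_kl)) /= !oddb => /negb_inj.
have low (l : 'I_K) :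
    `|split_sign R (sel l) i j * u (sel l * tperm i j)%g| <= `|u s|.
  rewrite /split_sign !in_front_sel.
  have odd_front x y : chi l x -> ~~ chi l y ->
      ~~ balanced (sel l * tperm x y)%g.
    move=> lx ly; rewrite negb_forall; apply/existsP; exists l; rewrite negbK.
    have := @miss_tperm l (sel l) x y; rewrite !in_front_sel lx ly miss_sel_id.
    by move=> /(_ isT isT); rewrite addn0 => ->.
  have [li|li] := boolP (chi l i); have [lj|lj] := boolP (chi l j).
  - by rewrite subrr mul0r normr0.
  - by rewrite mulr0n subr0 mul1r max_s ?odd_front.
  - by rewrite mulr0n sub0r mulN1r normrN tpermC max_s ?odd_front.
  - by rewrite subrr mul0r normr0.
have := crit i j ne_ij.
rewrite (bigD1 k) //= sign_k mul1r (bigID (fun l : 'I_K => (l < k)%N)) /=.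
rewrite [X in _ + (_ + X)]big1 => [|l /andP[ne_lk geq_lk]]; last first.
  rewrite high ?mul0r ?mulr0 // ltn_neqAle leqNgt geq_lk andbT.
  by rewrite eq_sym.
rewrite addr0 => /eqP; rewrite addr_eq0 => /eqP eq_k.
have : 2 ^+ k * `|u s| <= (2 ^+ k - 1) * `|u s|.
  rewrite -{1}u_k -[2 ^+ k in leLHS]ger0_norm ?exprn_ge0 // -normrM eq_k normrN.
  apply: le_trans (ler_norm_sum _ _ _) _.
  rewrite -sum_pow2 mulr_suml big_mkcond [leRHS]big_mkcond /=.
  apply: ler_sum => l _; have [ltlk|] := boolP (l < k)%N; last by rewrite andbF.
  rewrite andbT; case: eqP => [eq_lk | _] /=.
    by rewrite mulr_ge0 // exprn_ge0.
  rewrite normrM ger0_norm ?exprn_ge0 //.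
  apply: ler_wpM2l; first exact: exprn_ge0.
  exact: low.
by rewrite mulrBl mul1r lerBrDl gerDr.
Qed.

End NormalForm.

(** * Bounding the wedge square *)

Section UpperBound.
Variable R : realType.

(** A strictly increasing f satisfies i <= f i, and N - i <= N - f i by the
    same argument from the other end. *)
Lemma increasing_id N (f : {ffun 'I_N -> 'I_N}) :
  increasing f = (f == [ffun i => i]).
Proof.
apply/forallP/eqP => [incr | -> i]; last first.
  by apply/forallP=> j; rewrite !ffunE; apply/implyP.
have mono (i j : 'I_N) : (i < j)%N -> (f i < f j)%N.
  by have /forallP/(_ j)/implyP := incr i.
have lower m : forall i : 'I_N, i = m :> nat -> (m <= f i)%N.
  elim: m => // m IHm i def_i; have ltm : (m < N)%N by have := ltn_ord i; lia.
  by apply: leq_ltn_trans (IHm (Ordinal ltm) erefl) (mono _ _ _); rewrite /= def_i.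
have upper m : forall i : 'I_N, (i + m).+1 = N -> (f i + m < N)%N.
  elim: m => [|m IHm] i def_i; first by rewrite addn0.
  have ltm : (i.+1 < N)%N by lia.
  have := IHm (Ordinal ltm); have := mono i (Ordinal ltm) (ltnSn _).
  by move=> /= lt_f /(_ ltac:(lia)); lia.
apply/ffunP=> i; rewrite ffunE; apply/val_inj/eqP; rewrite eqn_leq /=.
have lti := ltn_ord i; rewrite lower // andbT.
by have := @upper (N - i.+1)%N i ltac:(lia); lia.
Qed.

Lemma form_norm_top N (W : 'M[R]_N -> R) : form_norm W = `|W 1%:M|.
Proof.
rewrite /form_norm (eq_bigl _ _ (@increasing_id N)) big_pred1_eq sqrtr_sqr.
congr `|W _|; apply/row_matrixP=> i.
by rewrite rowK row1 ffunE.
Qed.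

Definition unit_rows k n (A : 'M[R]_(k, n)) : Prop :=
  forall i, euclidean_norm (row i A) = 1.

Lemma orthogonal_unit_rows n (g : 'M[R]_n) : g *m g^T = 1%:M -> unit_rows g.
Proof.
move=> gg i; have := congr1 (fun h : 'M_n => h i i) gg.
rewrite !mxE eqxx /euclidean_norm => sum1; rewrite -[RHS]sqrtr1; congr Num.sqrt.
by rewrite -[RHS]sum1; apply: eq_bigr => j _; rewrite !mxE expr2.
Qed.

Lemma unit_rows_norm_le k n (w : 'M[R]_(k, n) -> R) M A :
  (0 < k)%N -> multilinear w -> (forall B, unit_rows B -> w B <= M) ->
  unit_rows A -> `|w A| <= M.
Proof.
move=> k_gt0 /multilinearP mw leM unitA; pose p := Ordinal k_gt0.
rewrite ler_norml leM // andbT lerNl.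
have -> : - w A = w (setrow p (- row p A) A).
  have := mw A p (-1) 0 (row p A) 0.
  by rewrite scale0r addr0 scaleN1r mul0r addr0 mulN1r setrow_id.
apply: leM => i; rewrite row_setrow; case: eqP => // _.
rewrite -(unitA p) /euclidean_norm; congr Num.sqrt.
by apply: eq_bigr => j _; rewrite !mxE sqrrN.
Qed.

Lemma wedge_coef n (w : 'M[R]_(n, n + n) -> R) (g : 'M[R]_(n + n)) :
  wedge w w g = (n`! * n`!)%:R^-1 *
    \sum_(s : 'S_(n + n)) (-1) ^+ s * (coef w g s * cocoef w g s).
Proof.
congr (_ * _); apply: eq_bigr => s _; congr (_ * (w _ * w _)).
  by apply/matrixP=> i j; rewrite !mxE.
by apply/matrixP=> i j; rewrite !mxE.
Qed.

(** Let eps be the sign of the wedge square. In a frame where the coefficients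
    dual_coef w eps g s vanish outside bal, the term of s in eps times the
    square is minus a square if s is not in bal, and at most M ^+ 2 in general. *)
Lemma wedge_square_le n (w : 'M[R]_(n, n + n) -> R) M (bal : pred 'S_(n + n)) :
    (0 < n)%N -> exterior_form w ->
    (forall eps : R, `|eps| = 1 -> exists2 g, special_orthogonal g &
       forall s, ~~ bal s -> dual_coef w eps g s = 0) ->
    (forall B, unit_rows B -> w B <= M) ->
  `|wedge w w 1%:M| <= (n`! * n`!)%:R^-1 * #|bal|%:R * M ^+ 2.
Proof.
move=> n_gt0 ew normal leM.
have [eps eps1 ->] : exists2 eps : R, `|eps| = 1 &
    `|wedge w w 1%:M| = eps * wedge w w 1%:M.
  have [ge0|lt0] := ger0P (wedge w w 1%:M).
    by exists 1; rewrite ?normr1 ?mul1r.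
  by exists (-1); rewrite ?normrN1 ?mulN1r.
have [g [gg detg] vanish] := normal eps eps1.
have ewedge := wedge_exterior ew.1 ew.1.
have -> : wedge w w 1%:M = wedge w w g.
  by rewrite (exterior_form_det g ewedge) detg mul1r.
rewrite wedge_coef.
rewrite mulrCA -mulrA ler_wpM2l ?invr_ge0 ?ler0n // mulr_sumr.
rewrite [leRHS]mulr_natl -sumr_const [leRHS]big_mkcond /=.
apply: ler_sum => s _; have [bal_s | unbal_s] := boolP (s \in bal).
  have le_M (e : 'I_n -> 'I_(n + n)) : `|w (rowsub e g)| <= M.
    apply: unit_rows_norm_le ew.1 leM _ => // i.
    by rewrite -(orthogonal_unit_rows gg (e i)); congr euclidean_norm;
       apply/rowP=> j; rewrite !mxE.
  apply: le_trans (ler_norm _) _; rewrite !normrM eps1 normr_sign !mul1r expr2.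
  by apply: ler_pM => //; exact: le_M.
have := vanish s unbal_s; rewrite /dual_coef => /eqP; rewrite addr_eq0 => /eqP->.
have -> : eps * ((-1) ^+ s * (- (eps * (-1) ^+ s * cocoef w g s) * cocoef w g s))
    = - (eps * (-1) ^+ s * cocoef w g s) ^+ 2.
  by move: (_ ^+ s) => z; ring.
by rewrite oppr_le0 sqr_ge0.
Qed.

(** Double counting: exactly one of the s j with m <= j equals X s, and by
    symmetry each j takes this role for the same number of permutations. *)
Lemma card_perm_at N (m : 'I_N) (X : 'S_N -> 'I_N) :
    (forall (s : 'S_N) (j : 'I_N), (j < m)%N -> s j != X s) ->
    (forall (s : 'S_N) (j : 'I_N), (m <= j)%N -> X (tperm m j * s)%g = X s) ->
  (#|[pred s : 'S_N | s m == X s]| * (N - m) = N`!)%N.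
Proof.
move=> X_new X_inv; rewrite -[RHS]card_Sn -[RHS]sum1_card.
transitivity (\sum_(s : 'S_N) \sum_(j < N | (m <= j)%N) (s j == X s))%N.
  rewrite exchange_big /=.
  transitivity (\sum_(j < N | (m <= j)%N) #|[pred s : 'S_N | s m == X s]|)%N.
    by rewrite -(big_geq_mkord m N predT (fun=> _)) sum_nat_const_nat mulnC.
  apply: eq_bigr => j le_mj; rewrite (reindex_inj (mulgI (tperm m j))) /=.
  rewrite -sum1_card big_mkcond; apply: eq_bigr => s _.
  by rewrite inE permM tpermR X_inv //; case: eqP.
apply: eq_bigr => s _; rewrite (bigD1 ((s^-1)%g (X s))) /=; last first.
  rewrite leqNgt; apply: contraL (eqxx (X s)) => lt_m.
  by have := X_new s _ lt_m; rewrite permKV.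
rewrite permKV eqxx big1 // => j /andP[_]; rewrite -(inj_eq (@perm_inj _ s)).
by rewrite permKV => /negPf->.
Qed.

End UpperBound.

(** * Affine planes over F_2 *)

Section Codes.

Definition bit (k x : nat) : bool := odd (x %/ 2 ^ k).

Lemma all_iotaP n (P : pred nat) :
  all P (iota 0 n) -> forall x, (x < n)%N -> P x.
Proof. by move=> /allP allP x lt_xn; apply: allP; rewrite mem_iota. Qed.

Notation "#8 k" := (@Ordinal (4 + 4) k isT) (at level 0, k at level 0).
Notation "#4 k" := (@Ordinal (2 + 2) k isT) (at level 0, k at level 0).

(** The index x < 8 stands for the vector of its binary digits in F_2^3, and
    the face k is the plane where the k-th coordinate vanishes. *)
Definition face8 (k : 'I_3) : pred 'I_(4 + 4) := fun x => ~~ bit k x.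

Definition face8_sel (k : 'I_3) : 'S_(4 + 4) :=
  if k == 0 :> nat then (tperm #8 1 #8 4 * tperm #8 3 #8 6)%g
  else if k == 1%N :> nat then (tperm #8 2 #8 4 * tperm #8 3 #8 5)%g
  else 1%g.

Definition swap8 : 'S_(4 + 4) :=
  (tperm #8 0 #8 4 * tperm #8 1 #8 5 * tperm #8 2 #8 6 * tperm #8 3 #8 7)%g.

Ltac cases8 x := case: x => [[|[|[|[|[|[|[|[|//]]]]]]]] ?].
Ltac cases4 x := case: x => [[|[|[|[|//]]]] ?].
Ltac cases3 x := case: x => [[|[|[|//]]] ?].

Lemma face8_selP k x : face8 k (face8_sel k x) = (x < 4)%N.
Proof.
rewrite /face8 /face8_sel; cases3 k => /=; rewrite ?permM ?perm1;
  cases8 x; by rewrite ?permE.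
Qed.

Lemma miss_face8_sel k l : k != l -> ~~ odd (miss face8 l (face8_sel k)).
Proof.
rewrite /miss !big_ord_recl big_ord0 /face8 /face8_sel.
by cases3 k; cases3 l; rewrite //= ?permM ?perm1 ?permE.
Qed.

Lemma swap8l p : swap8 (lshift 4 p) = rshift 4 p.
Proof. by cases4 p; apply/val_inj; rewrite /swap8 !permM !permE. Qed.

Lemma swap8r p : swap8 (rshift 4 p) = lshift 4 p.
Proof. by cases4 p; apply/val_inj; rewrite /swap8 !permM !permE. Qed.

Lemma swap8_even : ~~ odd_perm swap8.
Proof. by rewrite /swap8 !odd_permM !odd_tperm. Qed.

(** The sum of three vectors of F_2^3. *)
Definition xor3 (a b c : nat) : nat :=
  let sum k := bit k a (+) bit k b (+) bit k c in
  (sum 0 + 2 * sum 1 + 4 * sum 2)%N.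


Lemma xor3_lt a b c : (xor3 a b c < 4 + 4)%N.
Proof. by rewrite /xor3; do 3!case: (_ (+) _). Qed.

Lemma xor3_unique a b c d :
  (a < 8)%N -> (b < 8)%N -> (c < 8)%N -> (d < 8)%N ->
  ~~ odd (bit 0 a + bit 0 b + bit 0 c + bit 0 d) ->
  ~~ odd (bit 1 a + bit 1 b + bit 1 c + bit 1 d) ->
  ~~ odd (bit 2 a + bit 2 b + bit 2 c + bit 2 d) ->
  d == xor3 a b c.
Proof.
have check : all (fun a => all (fun b => all (fun c => all (fun d =>
    [&& ~~ odd (bit 0 a + bit 0 b + bit 0 c + bit 0 d),
        ~~ odd (bit 1 a + bit 1 b + bit 1 c + bit 1 d) &
        ~~ odd (bit 2 a + bit 2 b + bit 2 c + bit 2 d)]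
      ==> (d == xor3 a b c))
    (iota 0 8)) (iota 0 8)) (iota 0 8)) (iota 0 8) by vm_compute.
move=> lta ltb ltc ltd ea eb ec.
have := all_iotaP (all_iotaP (all_iotaP (all_iotaP check lta) ltb) ltc) ltd.
by rewrite ea eb ec.
Qed.

Lemma xor3_fresh a b c : (a < 8)%N -> (b < 8)%N -> (c < 8)%N ->
  a != b -> a != c -> b != c -> xor3 a b c \notin [:: a; b; c].
Proof.
have check : all (fun a => all (fun b => all (fun c =>
    [&& a != b, a != c & b != c] ==> (xor3 a b c \notin [:: a; b; c]))
  (iota 0 8)) (iota 0 8)) (iota 0 8) by vm_compute.
move=> lta ltb ltc ab ac bc.
have := all_iotaP (all_iotaP (all_iotaP check lta) ltb) ltc.
by rewrite ab ac bc.
Qed.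

(** The fourth point of the affine plane through the first three values. *)
Definition next8 (s : 'S_(4 + 4)) : 'I_(4 + 4) :=
  Ordinal (xor3_lt (s #8 0) (s #8 1) (s #8 2)).

(** Evenness at the face k says that the k-th coordinates of the four front
    values have sum 0 in F_2. *)
Lemma balanced8 s : balanced face8 s -> s #8 3 == next8 s.
Proof.
move=> /forallP bal; pose even k := ~~ odd
  (bit k (s #8 0) + bit k (s #8 1) + bit k (s #8 2) + bit k (s #8 3)).
have even_s (k : 'I_3) : even k.
  have := bal k; rewrite /miss !big_ord_recl big_ord0 /face8 !negbK addn0 /even.
  rewrite -!addnA; congr (~~ odd (bit k (s _) + (bit k (s _) +
    (bit k (s _) + bit k (s _))))); exact: val_inj.
rewrite -(inj_eq val_inj) [val (next8 s)]/=; apply: xor3_unique => //.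
- exact: ltn_ord.
- exact: (even_s (@Ordinal 3 0 isT)).
- exact: (even_s (@Ordinal 3 1 isT)).
- exact: (even_s (@Ordinal 3 2 isT)).
Qed.

(** The factor 5 is the number of places 3, ..., 7 left by the first three
    values, and 14 * (4! * 4!) * 5 = 8!. *)
Lemma card_balanced8 : (#|[pred s | balanced face8 s]| <= 14 * (4`! * 4`!))%N.
Proof.
have total : (14 * (4`! * 4`!) * 5 == (4 + 4)`!)%N by vm_compute.
rewrite -(@leq_pmul2r 5) // (eqP total).
rewrite -(@card_perm_at _ #8 3 next8) => [|s j lt_j3|s j le_3j].
- rewrite leq_mul2r; apply/subset_leq_card/fintype.subsetP=> s.
  by rewrite !inE => /balanced8.
- have ne i k : i != k -> s i != s k :> nat.
    by rewrite (inj_eq val_inj) (inj_eq perm_inj).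
  have := xor3_fresh (ltn_ord (s #8 0)) (ltn_ord (s #8 1)) (ltn_ord (s #8 2)).
  rewrite !ne // => /(_ isT isT isT); apply: contraNneq => eq_j.
  rewrite -[xor3 _ _ _]/(val (next8 s)) -eq_j !inE !(inj_eq val_inj).
  by rewrite !(inj_eq perm_inj); move: j lt_j3 {eq_j}; case=> [[|[|[|]]]].
- have fix_s (i : 'I_(4 + 4)) : (i < 3)%N -> (tperm #8 3 j * s)%g i = s i.
    move=> lt_i3; rewrite permM tpermD //.
      by apply: contraTneq lt_i3 => <-.
    by apply: contraTneq lt_i3 => <-; rewrite -leqNgt.
  by apply/val_inj; rewrite /= !fix_s.
Qed.

(** In R^4 a single face is enough; the balanced pairs are {0, 1} and {2, 3}. *)
Definition face4 (k : 'I_1) : pred 'I_(2 + 2) := fun x => (x < 2)%N.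

Definition swap4 : 'S_(2 + 2) := (tperm #4 0 #4 2 * tperm #4 1 #4 3)%g.

Lemma face4_selP k x : face4 k ((1%g : 'S_(2 + 2)) x) = (x < 2)%N.
Proof. by rewrite perm1. Qed.

Lemma swap4l p : swap4 (lshift 2 p) = rshift 2 p.
Proof.
by case: p => [[|[|//]] ?]; apply/val_inj; rewrite /swap4 !permM !permE.
Qed.

Lemma swap4r p : swap4 (rshift 2 p) = lshift 2 p.
Proof.
by case: p => [[|[|//]] ?]; apply/val_inj; rewrite /swap4 !permM !permE.
Qed.

Lemma swap4_even : ~~ odd_perm swap4.
Proof. by rewrite /swap4 !odd_permM !odd_tperm. Qed.

Definition partner (a : nat) : nat := nth 0 [:: 1; 0; 3; 2]%N a.

Lemma partner_lt a : (partner a < 2 + 2)%N.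
Proof. by case: a => [|[|[|[|a]]]] //; rewrite /partner /= nth_nil. Qed.

Definition next4 (s : 'S_(2 + 2)) : 'I_(2 + 2) := Ordinal (partner_lt (s #4 0)).

Lemma balanced4 s : balanced face4 s -> s #4 1 == next4 s.
Proof.
move=> /forallP/(_ ord0); rewrite /miss !big_ord_recl big_ord0 /face4 addn0.
have -> : lshift 2 ord0 = #4 0 by apply/val_inj.
have -> : lshift 2 (lift ord0 ord0) = #4 1 by apply/val_inj.
have : s #4 0 != s #4 1 by rewrite (inj_eq perm_inj).
rewrite -!(inj_eq val_inj) /=.
by case: (s #4 0) (s #4 1) => [[|[|[|[|//]]]] ?] [[|[|[|[|//]]]] ?].
Qed.

(** As above, with 2 * (2! * 2!) * 3 = 4!. *)
Lemma card_balanced4 : (#|[pred s | balanced face4 s]| <= 2 * (2`! * 2`!))%N.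
Proof.
have total : (2 * (2`! * 2`!) * 3 == (2 + 2)`!)%N by vm_compute.
rewrite -(@leq_pmul2r 3) // (eqP total).
rewrite -(@card_perm_at _ #4 1 next4) => [|s j lt_j1|s j le_1j].
- rewrite leq_mul2r; apply/subset_leq_card/fintype.subsetP=> s.
  by rewrite !inE => /balanced4.
- have -> : j = #4 0 by apply/val_inj; case: j lt_j1 => [[]].
  rewrite -(inj_eq val_inj) /=.
  by case: (s #4 0) => [[|[|[|[|//]]]] ?].
- by apply/val_inj; rewrite /= permM tpermD //; apply: contraTneq le_1j => ->.
Qed.

Variable R : realType.

Lemma wedge_square_le_nat n (w : 'M[R]_(n, n + n) -> R) M v
    (bal : pred 'S_(n + n)) :
    (0 < n)%N -> exterior_form w ->
    (forall eps : R, `|eps| = 1 -> exists2 g, special_orthogonal g &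
       forall s, ~~ bal s -> dual_coef w eps g s = 0) ->
    (forall B, unit_rows B -> w B <= M) ->
    (#|[pred s | bal s]| <= v * (n`! * n`!))%N ->
  `|wedge w w 1%:M| <= v%:R * M ^+ 2.
Proof.
move=> n_gt0 ew normal leM le_v.
apply: le_trans (wedge_square_le n_gt0 ew normal leM) _.
apply: ler_wpM2r; first exact: sqr_ge0.
rewrite mulrC ler_pdivrMr ?ltr0n ?muln_gt0 ?fact_gt0 //.
by rewrite -natrM ler_nat.
Qed.

Lemma wedge_square_le4 (w : 'M[R]_(4, 4 + 4) -> R) M :
    exterior_form w -> (forall B, unit_rows B -> w B <= M) ->
  `|wedge w w 1%:M| <= 14 * M ^+ 2.
Proof.
move=> ew leM.
apply: (wedge_square_le_nat _ ew _ leM card_balanced8) => // eps eps1.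
exact: (normal_form face8_selP miss_face8_sel ew eps1 isT isT swap8l swap8r
  swap8_even).
Qed.

Lemma wedge_square_le2 (w : 'M[R]_(2, 2 + 2) -> R) M :
    exterior_form w -> (forall B, unit_rows B -> w B <= M) ->
  `|wedge w w 1%:M| <= 2 * M ^+ 2.
Proof.
move=> ew leM.
apply: (wedge_square_le_nat _ ew _ leM card_balanced4) => // eps eps1.
apply: (normal_form face4_selP _ ew eps1 isT isT swap4l swap4r swap4_even).
by move=> k l; rewrite !ord1.
Qed.

End Codes.

(** * Sums over permutations and octonions *)

(** The alternating sum of F over the orderings of the sequence l, arranged as
    a recursion on the first entry so that it can be computed. *)
Fixpoint altsum n (l : seq nat) (F : seq nat -> int) : int :=
  if n is n'.+1 then
    foldr (fun j acc => (-1) ^+ odd j *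
      altsum n' (take j l ++ drop j.+1 l) (fun r => F (nth 0%N l j :: r)) + acc)
      0 (iota 0 n)
  else F [::].

Lemma sum_perm_ord0 n (f : 'S_n.+1 -> int) :
  \sum_(s : 'S_n.+1) f s =
  \sum_(j < n.+1) \sum_(s : 'S_n) f (lift_perm ord0 j s).
Proof.
rewrite pair_big /=.
pose h (js : 'I_n.+1 * 'S_n) := lift_perm ord0 js.1 js.2.
have injh : injective h.
  move=> [j s] [k t] /= eq_h.
  have eq_s x : lift_perm ord0 j s x = lift_perm ord0 k t x.
    by rewrite -[lift_perm _ _ s]/(h (j, s)) eq_h.
  have eq_jk : j = k by have := eq_s ord0; rewrite !lift_perm_id.
  rewrite -eq_jk in eq_s *; congr (_, _); apply/permP=> i.
  by apply: (@lift_inj _ j); rewrite -!(lift_perm_lift ord0) eq_s.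
rewrite (reindex h) //; apply: onW_bij; apply: inj_card_bij => //.
by rewrite card_prod card_ord !card_Sn factS.
Qed.

(** A permutation s with s 0 = j is lift_perm ord0 j t, of sign (-1)^j times
    that of t, as in the expansion of a determinant along a row. *)
Lemma altsumE n (l : seq nat) F : size l = n ->
  \sum_(s : 'S_n) (-1) ^+ s * F [seq nth 0%N l (s i) | i <- enum 'I_n] =
  altsum n l F.
Proof.
elim: n l F => [|n IHn] l F size_l.
  rewrite (bigD1 1%g) //= big1 => [|s]; last first.
    by case/negP; apply/eqP/permP; case.
  by rewrite odd_perm1 mul1r addr0 enum_ord0.
have foldr_sum (G : nat -> int) r :
    foldr (fun j acc => G j + acc) 0 r = \sum_(j <- r) G j.
  by elim: r => [|j r IHr] /=; rewrite ?big_nil // big_cons -IHr.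
rewrite sum_perm_ord0 /altsum -/altsum foldr_sum.
rewrite -[iota 0 n.+1]/(index_iota 0 n.+1) big_mkord; apply: eq_bigr => j _.
have lt_j : (j < size l)%N by rewrite size_l.
rewrite -IHn; last first.
  by rewrite size_cat size_drop size_takel ?size_l //; have := ltn_ord j; lia.
rewrite mulr_sumr; apply: eq_bigr => s _.
rewrite odd_lift_perm /= signr_addb mulrA; congr (_ * F _).
rewrite enum_ordSl /= lift_perm_id; congr (_ :: _).
rewrite -map_comp; apply: eq_map => i /=.
rewrite lift_perm_lift /= nth_cat size_takel ?(ltnW lt_j) // nth_drop /bump.
case: ltnP => [lt_ij | le_ji]; first by rewrite nth_take.
by congr nth; lia.
Qed.

Section Octonions.
Variable R : realType.

Lemma rowsub1 k n (e : 'I_k -> 'I_n) : rowsub e 1%:M = basis_frame R e.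
Proof.
by apply/row_matrixP=> i; rewrite rowK; apply/rowP=> j; rewrite !mxE eq_sym.
Qed.

Lemma basis_frame_unit k n (e : 'I_k -> 'I_n) : unit_rows (basis_frame R e).
Proof.
move=> i; rewrite rowK /euclidean_norm (bigD1 (e i)) //= big1 => [|j ne_j].
  by rewrite !mxE !eqxx expr1n addr0 sqrtr1.
by rewrite !mxE (negPf ne_j) andbF expr0n.
Qed.

Definition dot n (u v : 'rV[R]_n) : R := \sum_(j < n) u 0 j * v 0 j.

Lemma dotDl n (u v x : 'rV[R]_n) a b :
  dot (a *: u + b *: v) x = a * dot u x + b * dot v x.
Proof.
rewrite /dot !mulr_sumr -big_split; apply: eq_bigr => j _ /=.
by rewrite !mxE; ring.
Qed.

Lemma dotDr n (u v x : 'rV[R]_n) a b :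
  dot x (a *: u + b *: v) = a * dot x u + b * dot x v.
Proof.
rewrite /dot !mulr_sumr -big_split; apply: eq_bigr => j _ /=.
by rewrite !mxE; ring.
Qed.

Lemma dot_le1 n (u v : 'rV[R]_n) : dot u u = 1 -> dot v v = 1 -> dot u v <= 1.
Proof.
move=> u1 v1; have : 0 <= dot (1 *: u + (-1) *: v) (1 *: u + (-1) *: v).
  by apply: sumr_ge0 => j _; rewrite -expr2 sqr_ge0.
have -> : dot (1 *: u + (-1) *: v) (1 *: u + (-1) *: v) = 2 - 2 * dot u v.
  rewrite dotDl !dotDr u1 v1 (_ : dot v u = dot u v); first by ring.
  by apply: eq_bigr => j _; rewrite mulrC.
by lra.
Qed.

Lemma unit_rows_dot k n (A : 'M[R]_(k, n)) i :
  unit_rows A -> dot (row i A) (row i A) = 1.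
Proof.
move=> /(_ i); rewrite /euclidean_norm => sqrt1.
have -> : dot (row i A) (row i A) = \sum_(j < n) row i A 0 j ^+ 2.
  by apply: eq_bigr => j _; rewrite expr2.
rewrite -[LHS]sqr_sqrtr ?sqrt1 ?expr1n //.
by apply: sumr_ge0 => j _; exact: sqr_ge0.
Qed.

Definition xor8 (a b : 'I_(4 + 4)) : 'I_(4 + 4) := Ordinal (xor3_lt a b 0).

(** The exponent of the sign in e_a e_b = +- e_(a + b), which presents the
    octonions as a twisted group algebra of F_2^3. It is the Albuquerque-Majid
    cochain, the sum of the a_i b_j with i <= j and of the three cubic terms
    a_0 a_1 b_2 + a_0 b_1 a_2 + b_0 a_1 a_2. *)
Definition osign (a b : nat) : bool :=
  [&& bit 0 a & bit 0 b] (+) [&& bit 0 a & bit 1 b] (+)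
  [&& bit 0 a & bit 2 b] (+) [&& bit 1 a & bit 1 b] (+)
  [&& bit 1 a & bit 2 b] (+) [&& bit 2 a & bit 2 b] (+)
  [&& bit 0 a, bit 1 a & bit 2 b] (+) [&& bit 0 a, bit 1 b & bit 2 a] (+)
  [&& bit 0 b, bit 1 a & bit 2 a].

Definition omul (x y : 'rV[R]_(4 + 4)) : 'rV[R]_(4 + 4) :=
  \row_(c < 4 + 4) \sum_(a < 4 + 4)
    (-1) ^+ osign a (xor8 a c) * (x 0 a * y 0 (xor8 a c)).

Definition oconj (x : 'rV[R]_(4 + 4)) : 'rV[R]_(4 + 4) :=
  \row_(c < 4 + 4) ((-1) ^+ (0 < c)%N * x 0 c).

Lemma all2_ord8 (P : nat -> nat -> bool) :
  all (fun a => all (P a) (iota 0 8)) (iota 0 8) ->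
  forall a b : 'I_(4 + 4), P a b.
Proof.
by move=> allP a b; apply: (all_iotaP (all_iotaP allP (ltn_ord a)) (ltn_ord b)).
Qed.

Lemma all3_ord8 (P : nat -> nat -> nat -> bool) :
  all (fun a => all (fun b => all (P a b) (iota 0 8)) (iota 0 8)) (iota 0 8) ->
  forall a b c : 'I_(4 + 4), P a b c.
Proof.
move=> allP a b c.
exact: (all_iotaP (all_iotaP (all_iotaP allP (ltn_ord a)) (ltn_ord b)) (ltn_ord c)).
Qed.

Lemma xor8K a : involutive (xor8 a).
Proof.
move=> b; apply/val_inj/eqP; move: a b.
by apply: (@all2_ord8 (fun a b => xor3 a (xor3 a b 0) 0 == b)); vm_compute.
Qed.

(** The terms with factor x_a x_b, a <> b, in the square norm of omul x y
    cancel in pairs under the substitution of a + b + c for c: it exchanges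
    the two factors of y and reverses the sign. *)
Lemma omul_norm x y : dot (omul x y) (omul x y) = dot x x * dot y y.
Proof.
pose T (a b c : 'I_(4 + 4)) : R :=
  (-1) ^+ osign a (xor8 a c) * (-1) ^+ osign b (xor8 b c) *
  (x 0 a * x 0 b * (y 0 (xor8 a c) * y 0 (xor8 b c))).
have -> : dot (omul x y) (omul x y) = \sum_a \sum_b \sum_c T a b c.
  transitivity (\sum_c \sum_a \sum_b T a b c).
    apply: eq_bigr => c _; rewrite !mxE mulr_suml; apply: eq_bigr => a _.
    rewrite mulr_sumr; apply: eq_bigr => b _; rewrite /T.
    by move: (_ ^+ _) (_ ^+ _) => z1 z2; ring.
  rewrite exchange_big; apply: eq_bigr => a _; exact: exchange_big.
rewrite /dot mulr_suml; apply: eq_bigr => a _.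
rewrite (bigD1 a) //= [X in _ + X]big1 ?addr0 => [|b ne_ba].
  rewrite mulr_sumr [RHS](reindex_inj (inv_inj (xor8K a))).
  by apply: eq_bigr => c _; rewrite /T -expr2 sqrr_sign mul1r.
suff /eqP : \sum_c T a b c = - \sum_c T a b c.
  by rewrite -addr_eq0 -mulr2n mulrn_eq0 /= => /eqP.
rewrite {1}(reindex_inj (inv_inj (xor8K (xor8 a b)))) -sumrN /=.
apply: eq_bigr => c _; rewrite /T.
have ac : xor8 a (xor8 (xor8 a b) c) = xor8 b c.
  apply/val_inj/eqP; move: a b c {ne_ba}.
  apply: (@all3_ord8 (fun a b c =>
    xor3 a (xor3 (xor3 a b 0) c 0) 0 == xor3 b c 0)); by vm_compute.
have bc : xor8 b (xor8 (xor8 a b) c) = xor8 a c.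
  apply/val_inj/eqP; move: a b c {ne_ba ac}.
  apply: (@all3_ord8 (fun a b c =>
    xor3 b (xor3 (xor3 a b 0) c 0) 0 == xor3 a c 0)); by vm_compute.
have sign : osign a (xor8 b c) (+) osign b (xor8 a c) =
    ~~ (osign a (xor8 a c) (+) osign b (xor8 b c)).
  apply/eqP; move: ne_ba; apply/implyP; move: b a c {ac bc}.
  apply: (@all3_ord8 (fun b a c => (b != a) ==>
    (osign a (xor3 b c 0) (+) osign b (xor3 a c 0) ==
     ~~ (osign a (xor3 a c 0) (+) osign b (xor3 b c 0))))); by vm_compute.
rewrite ac bc -!signr_addb sign signrN.
by move: (_ ^+ _) => z; ring.
Qed.

Lemma omulDl u v y a b :
  omul (a *: u + b *: v) y = a *: omul u y + b *: omul v y.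
Proof.
apply/rowP=> c; rewrite !mxE !mulr_sumr -big_split; apply: eq_bigr => d _ /=.
by rewrite !mxE; move: (_ ^+ _) => z; ring.
Qed.

Lemma omulDr u v y a b :
  omul y (a *: u + b *: v) = a *: omul y u + b *: omul y v.
Proof.
apply/rowP=> c; rewrite !mxE !mulr_sumr -big_split; apply: eq_bigr => d _ /=.
by rewrite !mxE; move: (_ ^+ _) => z; ring.
Qed.

Lemma oconjD u v a b :
  oconj (a *: u + b *: v) = a *: oconj u + b *: oconj v.
Proof. by apply/rowP=> c; rewrite !mxE; move: (_ ^+ _) => z; ring. Qed.

Lemma oconj_norm x : dot (oconj x) (oconj x) = dot x x.
Proof.
apply: eq_bigr => c _; rewrite !mxE mulrACA -expr2 sqrr_sign.
by rewrite mul1r.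
Qed.

Lemma omul_basis a b :
  omul (delta_mx 0 a) (delta_mx 0 b) =
  (-1) ^+ osign a b *: delta_mx 0 (xor8 a b).
Proof.
apply/rowP=> c; rewrite !mxE (bigD1 a) //= big1 => [|d ne_da]; last first.
  by rewrite !mxE (negPf ne_da) mul0r mulr0.
rewrite addr0 !mxE !eqxx mul1r /=.
rewrite (inv_eq (xor8K a)).
have [->|_] := eqVneq c (xor8 a b); last by rewrite !mulr0n !mulr0.
by rewrite -[xor3 a _ 0]/(nat_of_ord (xor8 a (xor8 a b))) xor8K.
Qed.

Lemma oconj_basis (a : 'I_(4 + 4)) :
  oconj (delta_mx 0 a) = (-1) ^+ (0 < a)%N *: delta_mx 0 a.
Proof.
apply/rowP=> c; rewrite !mxE /=.
by have [->|ne_ca] := eqVneq c a; rewrite ?mulr0n ?mulr0.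
Qed.

End Octonions.

(** * The Cayley form *)

Section Cayley.
Variable R : realType.

Lemma omulZl c (x y : 'rV[R]_(4 + 4)) : omul (c *: x) y = c *: omul x y.
Proof. by have := omulDl x 0 y c 0; rewrite !scale0r !addr0. Qed.

Lemma omulZr c (x y : 'rV[R]_(4 + 4)) : omul x (c *: y) = c *: omul x y.
Proof. by have := omulDr y 0 x c 0; rewrite !scale0r !addr0. Qed.

Lemma dotZr n c (x y : 'rV[R]_n) : dot x (c *: y) = c * dot x y.
Proof. by have := dotDr y 0 x c 0; rewrite !scale0r mul0r !addr0. Qed.

Lemma dot_basis n (i j : 'I_n) :
  dot (delta_mx 0 i) (delta_mx 0 j) = (i == j)%:R :> R.
Proof.
rewrite /dot (bigD1 i) //= big1 => [|k ne_ki]; last first.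
  by rewrite !mxE (negPf ne_ki) mul0r.
by rewrite !mxE !eqxx mul1r addr0.
Qed.

Definition quad (x y z t : 'rV[R]_(4 + 4)) : R :=
  dot x (omul y (omul (oconj z) t)).

Lemma quad_le1 x y z t : dot x x = 1 -> dot y y = 1 -> dot z z = 1 ->
  dot t t = 1 -> quad x y z t <= 1.
Proof.
move=> x1 y1 z1 t1; apply: dot_le1 => //.
by rewrite !omul_norm oconj_norm y1 z1 t1 !mulr1.
Qed.

Lemma quadN x y z t : quad (- x) y z t = - quad x y z t.
Proof.
have := dotDl x 0 (omul y (omul (oconj z) t)) (-1) 0.
by rewrite scaleN1r scale0r addr0 mulN1r mul0r addr0.
Qed.

(** The value of quad on basis vectors, as an integer function that computes. *)
Definition quad_table (a b c d : nat) : int :=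
  if a == xor3 b (xor3 c d 0) 0 then
    (-1) ^+ (osign b (xor3 c d 0) (+) (osign c d (+) (0 < c)%N))
  else 0.

Definition cayley_table (a b c d : nat) : int :=
  quad_table a b c d - quad_table a d c b.

Lemma quad_basis (a b c d : 'I_(4 + 4)) :
  quad (delta_mx 0 a) (delta_mx 0 b) (delta_mx 0 c) (delta_mx 0 d) =
  (quad_table a b c d)%:~R.
Proof.
rewrite /quad oconj_basis omulZl omul_basis !omulZr omul_basis !dotZr dot_basis.
rewrite /quad_table -(inj_eq val_inj) /=; case: eqP => _; last by rewrite !mulr0.
by rewrite mulr1 rmorph_sign !signr_addb; ring.
Qed.

Notation "#r k" := (@Ordinal 4 k isT) (at level 0, k at level 0).

(** The Cayley calibration, with the triple cross product of octonions in its
    alternating form. *)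
Definition cayley (A : 'M[R]_(4, 4 + 4)) : R :=
  2^-1 * (quad (row #r 0 A) (row #r 1 A) (row #r 2 A) (row #r 3 A) -
          quad (row #r 0 A) (row #r 3 A) (row #r 2 A) (row #r 1 A)).

Lemma cayley_multilinear : multilinear cayley.
Proof.
apply/multilinearP=> A p a b u v; rewrite /cayley !row_setrow.
case: p => [[|[|[|[|//]]]] ?] /=; rewrite /quad.
- by rewrite !dotDl; ring.
- by rewrite !(omulDl, omulDr, dotDr); ring.
- by rewrite !(oconjD, omulDl, omulDr, dotDr); ring.
- by rewrite !(omulDl, omulDr, dotDr); ring.
Qed.

Lemma cayley_basis (f : 'I_4 -> 'I_(4 + 4)) :
  cayley (basis_frame R f) =
  2^-1 * (cayley_table (f #r 0) (f #r 1) (f #r 2) (f #r 3))%:~R.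
Proof. by rewrite /cayley !rowK !quad_basis /cayley_table rmorphB. Qed.

Lemma cayley_table_alternate (a b c d : nat) :
  (a < 8)%N -> (b < 8)%N -> (c < 8)%N -> (d < 8)%N ->
  [/\ cayley_table b a c d = - cayley_table a b c d,
      cayley_table c b a d = - cayley_table a b c d,
      cayley_table d b c a = - cayley_table a b c d &
    [/\ cayley_table a c b d = - cayley_table a b c d,
      cayley_table a d c b = - cayley_table a b c d &
      cayley_table a b d c = - cayley_table a b c d]].
Proof.
have check : all (fun a => all (fun b => all (fun c => all (fun d =>
    [&& cayley_table b a c d == - cayley_table a b c d,
        cayley_table c b a d == - cayley_table a b c d,
        cayley_table d b c a == - cayley_table a b c d,
        cayley_table a c b d == - cayley_table a b c d,
        cayley_table a d c b == - cayley_table a b c d &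
        cayley_table a b d c == - cayley_table a b c d])
    (iota 0 8)) (iota 0 8)) (iota 0 8)) (iota 0 8) by vm_compute.
move=> lta ltb ltc ltd.
have := all_iotaP (all_iotaP (all_iotaP (all_iotaP check lta) ltb) ltc) ltd.
case/and5P=> /eqP e1 /eqP e2 /eqP e3 /eqP e4 /andP[/eqP e5 /eqP e6].
exact: And4 e1 e2 e3 (And3 e4 e5 e6).
Qed.

Lemma cayley_exterior : exterior_form cayley.
Proof.
split; first exact: cayley_multilinear.
apply: (alternate_basis cayley_multilinear) => f i j ne_ij.
rewrite !cayley_basis -mulrN -mulrNz; congr (_ * _%:~R).
have [e1 e2 e3 [e4 e5 e6]] := cayley_table_alternate
  (ltn_ord (f #r 0)) (ltn_ord (f #r 1)) (ltn_ord (f #r 2)) (ltn_ord (f #r 3)).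
have ord_r (k : 'I_4) : [\/ k = #r 0, k = #r 1, k = #r 2 | k = #r 3].
  case: k => [[|[|[|[|//]]]] ?];
    [exact/Or41/val_inj|exact/Or42/val_inj|exact/Or43/val_inj|exact/Or44/val_inj].
by case: (ord_r i) ne_ij => ->; case: (ord_r j) => -> //= _; rewrite !permE /=.
Qed.

Lemma cayley_le1 A : unit_rows A -> cayley A <= 1.
Proof.
move=> unitA; have dot1 i := unit_rows_dot i unitA.
rewrite /cayley -quadN.
have le1 : quad (row #r 0 A) (row #r 1 A) (row #r 2 A) (row #r 3 A) <= 1.
  by rewrite quad_le1.
have le2 : quad (- row #r 0 A) (row #r 3 A) (row #r 2 A) (row #r 1 A) <= 1.
  by rewrite quad_le1 // -(dot1 #r 0); apply: eq_bigr => k _; rewrite !mxE mulrNN.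
by lra.
Qed.

(** A frame on which the Cayley form attains 1; with the first two vectors in
    their natural order the value is -1. *)
Definition odd_frame (i : 'I_4) : 'I_(4 + 4) :=
  lshift 4 (tperm #r 0 #r 1 i).

Lemma cayley_odd_frame : cayley (basis_frame R odd_frame) = 1.
Proof.
rewrite cayley_basis /odd_frame !permE /= (_ : cayley_table 1 0 2 3 = 2).
  by rewrite mulVf // pnatr_eq0.
by [].
Qed.

Lemma nth_perm_iota n (s : 'S_n) (k : 'I_n) :
  nth 0%N [seq nth 0%N (iota 0 n) (s i) | i <- enum 'I_n] k = s k.
Proof. by rewrite (nth_map k) ?size_enum_ord // nth_ord_enum nth_iota. Qed.

Definition cayley_pair (r : seq nat) : int :=
  cayley_table (nth 0 r 0)%N (nth 0 r 1)%N (nth 0 r 2)%N (nth 0 r 3)%N *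
  cayley_table (nth 0 r 4)%N (nth 0 r 5)%N (nth 0 r 6)%N (nth 0 r 7)%N.

Lemma cayley_pair_altsum :
  altsum (4 + 4) (iota 0 (4 + 4)) cayley_pair = - (14 * (4`! * 4`!) * 4)%N%:Z.
Proof. by apply/eqP; vm_compute. Qed.

(** The form is anti-self-dual for this orientation, hence the sign in
    cayley_pair_altsum. Its values on basis vectors are half of those of
    cayley_table, hence the factor 4. *)
Lemma cayley_square : `|wedge cayley cayley 1%:M| = 14.
Proof.
have rearrange (z x y : R) : z * (2^-1 * x * (2^-1 * y)) = 4^-1 * (z * (x * y)).
  by field.
rewrite wedge_coef.
have -> : \sum_(s : 'S_(4 + 4)) (-1) ^+ s *
      (coef cayley 1%:M s * cocoef cayley 1%:M s) =
    4^-1 * (altsum (4 + 4) (iota 0 (4 + 4)) cayley_pair)%:~R.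
  rewrite -(altsumE cayley_pair (size_iota 0 (4 + 4))) rmorph_sum mulr_sumr.
  apply: eq_bigr => s _.
  rewrite /coef /cocoef !rowsub1 !cayley_basis -!nth_perm_iota rmorphM rmorph_sign.
  by rewrite rearrange -[in LHS]rmorphM.
rewrite cayley_pair_altsum mulrNz mulrN mulrN normrN -pmulrn.
move: (4`!) (fact_gt0 4) => m m_gt0; rewrite !natrM.
have -> : (m%:R * m%:R)^-1 * (4^-1 * (14 * (m%:R * m%:R) * 4)) = 14 :> R.
  by field; rewrite pnatr_eq0 -lt0n.
by rewrite normr_nat.
Qed.

End Cayley.

(** * The symplectic form and the Wirtinger constants *)

Section Symplectic.
Variable R : realType.

Notation "#2 k" := (@Ordinal 2 k isT) (at level 0, k at level 0).
Notation "#4 k" := (@Ordinal (2 + 2) k isT) (at level 0, k at level 0).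

Definition symplectic (A : 'M[R]_(2, 2 + 2)) : R :=
  A #2 0 #4 0 * A #2 1 #4 1 - A #2 0 #4 1 * A #2 1 #4 0 +
  (A #2 0 #4 2 * A #2 1 #4 3 - A #2 0 #4 3 * A #2 1 #4 2).

Definition symplectic_table (a b : nat) : int :=
  ((a == 0) && (b == 1))%N%:Z - ((a == 1) && (b == 0))%N%:Z +
  (((a == 2) && (b == 3))%N%:Z - ((a == 3) && (b == 2))%N%:Z).

Lemma symplectic_exterior : exterior_form symplectic.
Proof.
split.
  apply/multilinearP=> A p a b u v; rewrite /symplectic !mxE.
  by case: p => [[|[|//]] ?] /=; ring.
move=> A i j ne_ij eqA.
have {i j ne_ij eqA} eqA k : A #2 0 k = A #2 1 k.
  have ord2 (p : 'I_2) : p = #2 0 \/ p = #2 1.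
    by case: p => [[|[|//]] ?]; [left | right]; exact: val_inj.
  move/rowP/(_ k): eqA; rewrite !mxE.
  by case: (ord2 i) ne_ij => ->; case: (ord2 j) => -> // _ /esym.
by rewrite /symplectic !eqA; ring.
Qed.

Lemma symplectic_basis (f : 'I_2 -> 'I_(2 + 2)) :
  symplectic (basis_frame R f) = (symplectic_table (f #2 0) (f #2 1))%:~R.
Proof.
rewrite /symplectic !mxE /= /symplectic_table.
by case: (f #2 0) (f #2 1) => [[|[|[|[|//]]]] ?] [[|[|[|[|//]]]] ?] /=;
  rewrite ?mulr0n ?mulr1n; ring.
Qed.

Lemma symplectic_le1 A : unit_rows A -> symplectic A <= 1.
Proof.
move=> unitA; have := unit_rows_dot #2 0 unitA; have := unit_rows_dot #2 1 unitA.
have ord_row i : dot (row i A) (row i A) =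
    A i #4 0 ^+ 2 + A i #4 1 ^+ 2 + A i #4 2 ^+ 2 + A i #4 3 ^+ 2.
  rewrite /dot !big_ord_recl big_ord0 !mxE !addr0 -!expr2 !addrA.
  by congr (A _ _ ^+ 2 + A _ _ ^+ 2 + A _ _ ^+ 2 + A _ _ ^+ 2); exact: val_inj.
rewrite !ord_row /symplectic.
move: (A #2 0 #4 0) (A #2 0 #4 1) (A #2 0 #4 2) (A #2 0 #4 3) => x0 x1 x2 x3.
move: (A #2 1 #4 0) (A #2 1 #4 1) (A #2 1 #4 2) (A #2 1 #4 3) => y0 y1 y2 y3.
have := sqr_ge0 (x0 - y1); have := sqr_ge0 (x1 + y0).
have := sqr_ge0 (x2 - y3); have := sqr_ge0 (x3 + y2).
by rewrite !expr2; nra.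
Qed.

Definition symplectic_pair (r : seq nat) : int :=
  symplectic_table (nth 0 r 0)%N (nth 0 r 1)%N *
  symplectic_table (nth 0 r 2)%N (nth 0 r 3)%N.

Lemma symplectic_pair_altsum :
  altsum (2 + 2) (iota 0 (2 + 2)) symplectic_pair = (2 * (2`! * 2`!))%N%:Z.
Proof. by apply/eqP; vm_compute. Qed.

Lemma symplectic_square : `|wedge symplectic symplectic 1%:M| = 2.
Proof.
rewrite wedge_coef.
have -> : \sum_(s : 'S_(2 + 2)) (-1) ^+ s *
      (coef symplectic 1%:M s * cocoef symplectic 1%:M s) =
    (altsum (2 + 2) (iota 0 (2 + 2)) symplectic_pair)%:~R :> R.
  rewrite -(altsumE symplectic_pair (size_iota 0 (2 + 2))) rmorph_sum.
  apply: eq_bigr => s _.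
  rewrite /coef /cocoef !rowsub1 !symplectic_basis -!nth_perm_iota.
  by rewrite rmorphM rmorph_sign -[in LHS]rmorphM.
rewrite symplectic_pair_altsum -pmulrn.
move: (2`!) (fact_gt0 2) => m m_gt0; rewrite !natrM.
have -> : (m%:R * m%:R)^-1 * (2 * (m%:R * m%:R)) = 2 :> R.
  by field; rewrite pnatr_eq0 -lt0n.
by rewrite normr_nat.
Qed.

Local Open Scope classical_set_scope.

Lemma comass_eq1 k n (w : 'M[R]_(k, n) -> R) A :
  unit_rows A -> w A = 1 -> (forall B, unit_rows B -> w B <= 1) -> comass w = 1.
Proof.
move=> unitA wA le1; apply: maxval_eq; first by exists A.
by move=> _ [B unitB <-]; exact: le1.
Qed.

(** If the comass of w were not attained it would be 0 by convention, and so
    would be the ratio, as x / 0 = 0. *)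
Lemma max_ratio n (v : R) (w0 : 'M[R]_(n, n + n) -> R) :
    (forall (w : 'M[R]_(n, n + n) -> R) M, exterior_form w ->
       (forall B, unit_rows B -> w B <= M) ->
       `|wedge w w 1%:M| <= v * M ^+ 2) ->
    exterior_form w0 -> comass w0 = 1 -> `|wedge w0 w0 1%:M| = v ->
  maxval [set form_norm (wedge w w) / comass w ^+ 2 | w in
           [set w : 'M[R]_(n, n + n) -> R |
              exterior_form w /\ w <> (fun=> 0)]] = v.
Proof.
move=> upper ew0 comass1 square0; apply: maxval_eq.
  exists w0; last by rewrite form_norm_top square0 comass1 expr1n divr1.
  split=> // w0_0; have : comass w0 != 0 by rewrite comass1 oner_eq0.
  case/maxval_neq0=> -[A _ wA] _; move: comass1.
  by rewrite /comass -wA w0_0 => /eqP; rewrite eq_sym oner_eq0.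
move=> _ [w [ew _] <-]; rewrite form_norm_top.
have [->|comass_n0] := eqVneq (comass w) 0.
  rewrite expr0n invr0 mulr0 -square0; exact: normr_ge0.
have [_ max_comass] := maxval_neq0 comass_n0.
rewrite ler_pdivrMr ?exprn_even_gt0 //; apply: upper => // B unitB.
by apply: max_comass; exists B.
Qed.

End Symplectic.

Theorem proposition9p1 (R : realType) : Wirt R 2 = 2 /\ Wirt R 4 = 14.
Proof.
split.
  apply: (@max_ratio R 2 2 (@symplectic R)).
  - exact: wedge_square_le2.
  - exact: symplectic_exterior.
  - apply: (@comass_eq1 R _ _ _ (basis_frame R (@lshift 2 2))).
    + exact: basis_frame_unit.
    + by rewrite symplectic_basis.
    + exact: symplectic_le1.
  - exact: symplectic_square.
apply: (@max_ratio R 4 14 (@cayley R)).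
- exact: wedge_square_le4.
- exact: cayley_exterior.
- apply: comass_eq1 (cayley_odd_frame R) (@cayley_le1 R).
  exact: basis_frame_unit.
- exact: cayley_square.
Qed.
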